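(* Let $A \in \mathbb{Z}^{m \times n}$ have rank $n$ and primitive rows. For any $\mathbf{b} \in \mathbb{Z}^m$, the small Chvátal rank of $A\mathbf{x} \leq \mathbf{b}$ is at most the Chvátal rank of the same system, and the small Chvátal rank of $A$ is at most the Chvátal rank of $A$. In particular, the small Chvátal rank is always finite.
   Context: A vector in $\mathbb{Z}^n$ is primitive if the gcd of its components is one. For a rational polyhedral cone $K$, a Hilbert basis of $K$ is a finite set $H \subset K \cap \mathbb{Z}^n$ such that every element of $K \cap \mathbb{Z}^n$ is a nonnegative integer combination of elements of $H$; a pointed $K$ has a unique minimal Hilbert basis. For $\mathbf{b} \in \mathbb{Z}^m$, $Q_{\mathbf{b}} = \{\mathbf{x} \in \mathbb{R}^n : A\mathbf{x} \leq \mathbf{b}\}$ and $Q_{\mathbf{b}}^I = \mathrm{conv}(Q_{\mathbf{b}} \cap \mathbb{Z}^n)$. Small Chvátal rank. Let $\mathcal{A}$ be the set of rows of $A$. A basis in a set $\mathcal{V} \subset \mathbb{Z}^n$ is a subset of $n$ linearly independent vectors, and the cone generated by a basis is a basis cone of $\mathcal{V}$. Iterated basis normalization: $\mathcal{A}^{(0)} := \mathcal{A}$, and for $k \geq 1$, $\mathcal{A}^{(k)}$ is the union of the minimal Hilbert bases of all basis cones of $\mathcal{A}^{(k-1)}$. $A^{(k)}$ denotes a matrix whose rows are the elements of $\mathcal{A}^{(k)}$ (with $A^{(0)}=A$). The small Chvátal rank (SCR) of $A\mathbf{x} \leq \mathbf{b}$ is the smallest $k$ such that there is an integer vector $\mathbf{b}'$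 with $Q_{\mathbf{b}}^I = \{\mathbf{x} \in \mathbb{R}^n : A^{(k)}\mathbf{x} \leq \mathbf{b}'\}$. The SCR of $A$ is the supremum of the SCRs of $A\mathbf{x} \leq \mathbf{b}$ over $\mathbf{b} \in \mathbb{Z}^m$. Chvátal rank. For a rational polyhedron $Q = \{\mathbf{x} : U\mathbf{x} \leq \mathbf{u}\}$ with $U$ integral of rank $n$, and a vertex $\mathbf{v}$ of $Q$, let $\mathcal{U}_{\mathbf{v}}$ be the set of rows of $U$ whose inequalities hold with equality at $\mathbf{v}$. $Q^{(1)}$ is the polyhedron cut out by the inequalities $\mathbf{h} \cdot \mathbf{x} \leq \lfloor \mathbf{h} \cdot \mathbf{v} \rfloor$ for all vertices $\mathbf{v}$ of $Q$ and all $\mathbf{h}$ in a minimal Hilbert basis of $\mathrm{cone}(\mathcal{U}_{\mathbf{v}})$ (this depends only on $Q$). Set $Q^{(0)} = Q$ and $Q^{(i)} = (Q^{(i-1)})^{(1)}$ for $i\ge 2$. The Chvátal rank of $A\mathbf{x} \leq \mathbf{b}$ is the smallest $t$ with $Q_{\mathbf{b}}^{(t)} = Q_{\mathbf{b}}^I$, and the Chvátal rank of $A$ is the maximum over all $\mathbf{b} \in \mathbb{Z}^m$ of the Chvátal ranks of $A\mathbf{x} \leq \mathbf{b}$. It is a known theorem that all these Chvátal ranks are finite. *)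

(* Defs.v *)
From HB Require Import structures.
From mathcomp Require Import all_boot all_order all_algebra finmap.
From mathcomp Require Import all_classical all_reals ereal.

Set Implicit Arguments.
Unset Strict Implicit.
Unset Printing Implicit Defensive.

Import Order.TTheory GRing.Theory Num.Theory.
Local Open Scope classical_set_scope.
Local Open Scope ring_scope.

(* Points of R^n are column vectors; integer inequality normals (rows of
   constraint matrices, generators of cones) are row vectors. *)

Definition primitive n (v : 'rV[int]_n) : Prop :=
  (\big[gcdn/0]_(j < n) `|v ord0 j|)%N = 1%N.

Definition int_rank m n (A : 'M[int]_(m, n)) : nat :=
  \rank (map_mx intr A : 'M[rat]_(m, n)).

Section Polyhedra.
Variable R : realType.

Definition dot n (h : 'rV[int]_n) (x : 'cV[R]_n) : R :=
  ((map_mx intr h : 'rV[R]_n) *m x) ord0 ord0.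

Definition polyhedron m n (U : 'M[int]_(m, n)) (u : 'cV[R]_m) : set 'cV[R]_n :=
  [set x | forall i, dot (row i U) x <= u i ord0].

Definition int_points n : set 'cV[R]_n :=
  [set x | exists z : 'cV[int]_n, x = map_mx intr z].

Definition conv n (X : set 'cV[R]_n) : set 'cV[R]_n :=
  [set x | exists (k : nat) (p : 'I_k -> 'cV[R]_n) (c : 'I_k -> R),
    [/\ forall i, X (p i), forall i, 0 <= c i,
        \sum_i c i = 1 & x = \sum_i c i *: p i]].

Definition integer_hull n (Q : set 'cV[R]_n) : set 'cV[R]_n :=
  conv (Q `&` @int_points n).

Definition cone n (S : set 'rV[int]_n) : set 'rV[R]_n :=
  [set y | exists (k : nat) (s : 'I_k -> 'rV[int]_n) (c : 'I_k -> R),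
    [/\ forall i, S (s i), forall i, 0 <= c i
      & y = \sum_i c i *: map_mx intr (s i)]].

Definition hilbert_basis n (K : set 'rV[R]_n) (H : {fset 'rV[int]_n}) : Prop :=
  (forall h, h \in H -> K (map_mx intr h)) /\
  (forall z : 'rV[int]_n, K (map_mx intr z) ->
    exists c : 'rV[int]_n -> nat, z = \sum_(h <- H) h *+ c h).

Definition min_hilbert_basis n (K : set 'rV[R]_n) (H : {fset 'rV[int]_n}) :
    Prop :=
  hilbert_basis K H /\
  forall H' : {fset 'rV[int]_n},
    hilbert_basis K H' -> (H' `<=` H)%fset -> H' = H.

(* The rows of B, in any order, form a basis in V. *)
Definition basis_in n (V : set 'rV[int]_n) (B : 'M[int]_n) : Prop :=
  row_free (map_mx intr B : 'M[rat]_n) /\ forall i, V (row i B).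

Definition rows m n (A : 'M[int]_(m, n)) : set 'rV[int]_n :=
  range (fun i : 'I_m => row i A).

Definition basis_normalization n (V : set 'rV[int]_n) : set 'rV[int]_n :=
  [set h | exists (B : 'M[int]_n) (H : {fset 'rV[int]_n}),
    [/\ basis_in V B, min_hilbert_basis (cone (rows B)) H & h \in H]].

Definition ibn m n (A : 'M[int]_(m, n)) (k : nat) : set 'rV[int]_n :=
  iter k (@basis_normalization n) (rows A).

Definition Qb m n (A : 'M[int]_(m, n)) (b : 'cV[int]_m) : set 'cV[R]_n :=
  polyhedron A (map_mx intr b).

(* The right-hand side b' of A^(k) x <= b' is indexed by the normals
   themselves; its values outside A^(k) are irrelevant. *)
Definition scr_at_stage m n (A : 'M[int]_(m, n)) (b : 'cV[int]_m) (k : nat) :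
    Prop :=
  exists b' : 'rV[int]_n -> int,
    integer_hull (Qb A b) =
    [set x | forall a, ibn A k a -> dot a x <= (b' a)%:~R].

(* Smallest element of a set of naturals, +oo if there is none. *)
Definition least (P : set nat) : \bar R :=
  ereal_inf [set (k%:R : R)%:E | k in P].

Definition scr m n (A : 'M[int]_(m, n)) (b : 'cV[int]_m) : \bar R :=
  least (scr_at_stage A b).

Definition scr_matrix m n (A : 'M[int]_(m, n)) : \bar R :=
  ereal_sup (range (scr A)).

(* A vertex is an extreme point. *)
Definition vertex n (Q : set 'cV[R]_n) (v : 'cV[R]_n) : Prop :=
  Q v /\
  forall (x y : 'cV[R]_n) (t : R), Q x -> Q y -> 0 < t -> t < 1 ->
    v = t *: x + (1 - t) *: y -> x = y.

Definition tight_rows m n (U : 'M[int]_(m, n)) (u : 'cV[R]_m) (v : 'cV[R]_n) :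
    set 'rV[int]_n :=
  [set row i U | i in [set i | dot (row i U) v = u i ord0]].

(* Q' is the polyhedron Q^(1) computed from some description U x <= u of the
   rational polyhedron Q, with H v the chosen minimal Hilbert basis at v (not
   unique when Q is not full-dimensional). Q' does not depend on these choices.
   If Q is empty there is no vertex, hence no inequality; this has no effect on
   the Chvatal rank: Q^(t) contains the integer hull of Q, so an empty Q^(t)
   already equals it. *)
Definition chvatal_closure n (Q Q' : set 'cV[R]_n) : Prop :=
  exists (m : nat) (U : 'M[int]_(m, n)) (u : 'cV[rat]_m)
         (H : 'cV[R]_n -> {fset 'rV[int]_n}),
    [/\ int_rank U = n,
        Q = polyhedron U (map_mx ratr u),
        forall v, vertex Q v ->
          min_hilbert_basis (cone (tight_rows U (map_mx ratr u) v)) (H v)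
      & Q' = [set x | forall v, vertex Q v -> forall h, h \in H v ->
                dot h x <= (Num.floor (dot h v))%:~R]].

(* chvatal_iter t Q Q' : Q' is Q^(t). *)
Fixpoint chvatal_iter n (t : nat) (Q Q' : set 'cV[R]_n) : Prop :=
  if t is t'.+1 then
    exists Q1, chvatal_iter t' Q Q1 /\ chvatal_closure Q1 Q'
  else Q' = Q.

Definition chvatal_rank m n (A : 'M[int]_(m, n)) (b : 'cV[int]_m) : \bar R :=
  least [set t | chvatal_iter t (Qb A b) (integer_hull (Qb A b))].

(* A supremum, which is a maximum whenever it is finite. *)
Definition chvatal_rank_matrix m n (A : 'M[int]_(m, n)) : \bar R :=
  ereal_sup (range (chvatal_rank A)).

End Polyhedra.

(* Main.v *)
Require Import Defs.
From mathcomp Require Import all_boot all_order all_algebra finmap.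
From mathcomp Require Import all_classical all_reals ereal.
From mathcomp Require Import zify ring lra.

Set Implicit Arguments.
Unset Strict Implicit.
Unset Printing Implicit Defensive.

Import Order.TTheory GRing.Theory Num.Theory.
Local Open Scope classical_set_scope.
Local Open Scope ring_scope.

(** Write [cg X] for the set obtained from [X] by rounding down the right-hand
    side of every valid inequality with an integral normal, and [Q] for the
    polyhedron [A x <= b].  The number of rounds of [cg] that leads from [Q] into
    its integer hull is the bridge between the two ranks.

    The Chvatal rank is at least this number: the inequalities that cut out a
    Chvatal closure are valid inequalities with rounded right-hand sides, so each
    closure contains the result of one round of [cg] ([cg_chvatal_closure]).

    The small Chvatal rank is at most this number when [Q] has a lattice point.
    Give each normal [a] produced by basis normalization the largest value that it
    takes on the lattice points of [Q].  Let [h x <= c] be valid for the polyhedron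
    cut out by the normals of stage [k].  By linear programming duality and
    Caratheodory's argument, [h] lies in a basis cone of these normals, with a
    combination of right-hand sides of at most [c]; then [h] is a nonnegative
    integer combination of the Hilbert basis of that cone, whose elements are
    normals of stage [k+1].  Their right-hand sides are integers, so stage [k+1]
    implies [h x <= floor c].  Hence a normalization step is at least as strong as a
    round of [cg] ([normalization_cut], [ibn_cut]).

    If [Q] has no lattice point, stage 0 already suffices: some row of [A] vanishes
    on the recession cone, for otherwise an interior direction of that cone would
    lead to lattice points, and by Farkas' lemma the rows of [A] then satisfy a
    nontrivial nonnegative relation.  So [A x <= -1] is infeasible
    ([scr_at_stage0_empty]).

    It remains to bound the number of rounds uniformly in [b].  For a single system
    with a lattice point, the integer hull is a polyhedron ([integer_hull_finite]),
    and each of its inequalities [w x <= d] is reached by lowering a right-hand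
    side in unit steps.  A step is possible because the face [w x = d'] with
    [d' > d] has no lattice point and because cuts on a face come from cuts on the
    whole polyhedron ([cg_slice]); the faces disappear by induction on the dimension
    ([cg_empty]).
    This is [cg_finite].  For the uniform bound, fix an inequality of the integer
    hull and a point [v] of [Q] that maximizes its normal.  Rows that are very
    slack at [v] may be dropped, since every lattice point of the relaxed system
    can be moved close to [v] without loss ([proximity]).  After a translation by a
    lattice point near [v], the remaining right-hand sides are bounded, so that only
    finitely many systems occur ([cg_uniform]). *)

(** * Finitely generated cones *)

Section Cones.
Variable R : realType.

Definition pairing n (y : 'rV[R]_n) (x : 'cV[R]_n) : R := (y *m x) ord0 ord0.

Definition ipair n (h : 'rV[int]_n) (z : 'cV[int]_n) : int :=
  (h *m z) ord0 ord0.

Definition real_mx m n (M : 'M[int]_(m, n)) : 'M[R]_(m, n) := map_mx intr M.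

Lemma dotE n (h : 'rV[int]_n) (x : 'cV[R]_n) : dot h x = pairing (real_mx h) x.
Proof. by []. Qed.

Lemma pairDl n (y y' : 'rV[R]_n) x : pairing (y + y') x = pairing y x + pairing y' x.
Proof. by rewrite /pairing mulmxDl mxE. Qed.

Lemma pairDr n (y : 'rV[R]_n) x x' : pairing y (x + x') = pairing y x + pairing y x'.
Proof. by rewrite /pairing mulmxDr mxE. Qed.

Lemma pairZl n c (y : 'rV[R]_n) x : pairing (c *: y) x = c * pairing y x.
Proof. by rewrite /pairing -scalemxAl mxE. Qed.

Lemma pairZr n c (y : 'rV[R]_n) x : pairing y (c *: x) = c * pairing y x.
Proof. by rewrite /pairing -scalemxAr mxE. Qed.

Lemma pairNl n (y : 'rV[R]_n) x : pairing (- y) x = - pairing y x.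
Proof. by rewrite /pairing mulNmx mxE. Qed.

Lemma pairNr n (y : 'rV[R]_n) x : pairing y (- x) = - pairing y x.
Proof. by rewrite /pairing mulmxN mxE. Qed.

Lemma pairBl n (y y' : 'rV[R]_n) x : pairing (y - y') x = pairing y x - pairing y' x.
Proof. by rewrite pairDl pairNl. Qed.

Lemma pairBr n (y : 'rV[R]_n) x x' : pairing y (x - x') = pairing y x - pairing y x'.
Proof. by rewrite pairDr pairNr. Qed.

Lemma pair0l n x : pairing (0 : 'rV[R]_n) x = 0.
Proof. by rewrite /pairing mul0mx mxE. Qed.

Lemma pair_suml n I (s : seq I) (P : pred I) (F : I -> 'rV[R]_n) x :
  pairing (\sum_(i <- s | P i) F i) x = \sum_(i <- s | P i) pairing (F i) x.
Proof. by rewrite /pairing mulmx_suml summxE. Qed.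

Lemma pair_sumr n I (s : seq I) (P : pred I) (F : I -> 'cV[R]_n) y :
  pairing y (\sum_(i <- s | P i) F i) = \sum_(i <- s | P i) pairing y (F i).
Proof. by rewrite /pairing mulmx_sumr summxE. Qed.

Lemma pair_tr n (y : 'rV[R]_n) x : pairing x^T y^T = pairing y x.
Proof. by rewrite /pairing -trmx_mul mxE. Qed.

Lemma real_mxD m n (M N : 'M[int]_(m, n)) :
  real_mx (M + N) = real_mx M + real_mx N.
Proof. exact: map_mxD. Qed.

Lemma real_mxN m n (M : 'M[int]_(m, n)) : real_mx (- M) = - real_mx M.
Proof. exact: map_mxN. Qed.

Lemma real_mxB m n (M N : 'M[int]_(m, n)) :
  real_mx (M - N) = real_mx M - real_mx N.
Proof. exact: map_mxB. Qed.

Lemma real_mx0 m n : real_mx (0 : 'M[int]_(m, n)) = 0.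
Proof. exact: map_mx0. Qed.

Lemma real_mxZ m n c (M : 'M[int]_(m, n)) :
  real_mx (c *: M) = c%:~R *: real_mx M.
Proof. exact: map_mxZ. Qed.

Lemma real_mxM m n p (M : 'M[int]_(m, n)) (N : 'M[int]_(n, p)) :
  real_mx (M *m N) = real_mx M *m real_mx N.
Proof. exact: map_mxM. Qed.

Lemma real_mx_tr m n (M : 'M[int]_(m, n)) : real_mx M^T = (real_mx M)^T.
Proof. by rewrite /real_mx map_trmx. Qed.

Lemma real_mx_sum m n I (s : seq I) (P : pred I) (F : I -> 'M[int]_(m, n)) :
  real_mx (\sum_(i <- s | P i) F i) = \sum_(i <- s | P i) real_mx (F i).
Proof. exact: (big_morph _ (@real_mxD m n) (@real_mx0 m n)). Qed.

Lemma real_mxMn m n (M : 'M[int]_(m, n)) k : real_mx (M *+ k) = real_mx M *+ k.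
Proof. by elim: k => [|k IH]; rewrite ?mulr0n ?real_mx0 // !mulrS real_mxD IH. Qed.

Lemma pair_int n (h : 'rV[int]_n) (z : 'cV[int]_n) :
  pairing (real_mx h) (real_mx z) = (ipair h z)%:~R.
Proof. by rewrite /pairing -real_mxM /real_mx mxE. Qed.

Definition conic n (s : seq 'rV[int]_n) (y : 'rV[R]_n) : Prop :=
  exists c : nat -> R, (forall i, 0 <= c i) /\
    y = \sum_(i < size s) c i *: real_mx s`_i.

Lemma conic_cons n a (s : seq 'rV[int]_n) y :
  conic (a :: s) y <-> exists2 t, 0 <= t & conic s (y - t *: real_mx a).
Proof.
split=> [[c [c0 ->]]|[t t0 [c [c0 e]]]].
  exists (c 0%N) => //; exists (fun i => c i.+1); split=> //=.
  by rewrite big_ord_recl /= addrC addKr.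
exists (fun i => if i is j.+1 then c j else t); split; first by case.
by rewrite /= big_ord_recl /= -e addrC subrK.
Qed.

Lemma conic_pair_ge0 n (s : seq 'rV[int]_n) y x :
  (forall a, a \in s -> 0 <= dot a x) -> conic s y -> 0 <= pairing y x.
Proof.
move=> sx [c [c0 ->]]; rewrite pair_suml sumr_ge0 // => i _.
by rewrite pairZl mulr_ge0 // sx // mem_nth.
Qed.

Lemma conic_mem n (s : seq 'rV[int]_n) a : a \in s -> conic s (real_mx a).
Proof.
move=> /(nthP 0)[i lt_is <-].
exists (fun j => (j == i)%:R); split=> [j|]; first exact: ler0n.
rewrite (bigD1 (Ordinal lt_is)) //= eqxx scale1r big1 ?addr0 // => j ne.
have /negPf-> : val j != i by apply: contra ne => /eqP e; apply/eqP/val_inj.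
by rewrite scale0r.
Qed.

(** The list is the Fourier-Motzkin elimination of [t] from the inequalities
    [0 <= t] and [0 <= (y - t a) g]: lower bounds on [t] come from the [g] with
    [a g < 0], upper bounds from those with [a g > 0]. *)
Definition eliminate n (a : 'rV[int]_n) (G : seq 'cV[int]_n) : seq 'cV[int]_n :=
  [seq g <- G | 0 <= ipair a g] ++
  [seq ipair a p.1 *: p.2 - ipair a p.2 *: p.1 |
    p <- [seq (g, g') | g <- [seq g <- G | 0 < ipair a g],
                        g' <- [seq g <- G | ipair a g < 0]]].

Lemma eliminateP n (a : 'rV[int]_n) (G : seq 'cV[int]_n) (y : 'rV[R]_n) :
  (forall g, g \in eliminate a G -> 0 <= pairing y (real_mx g)) <->
  (exists2 t, 0 <= t & forall g, g \in G -> 0 <= pairing (y - t *: real_mx a) (real_mx g)).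
Proof.
have pE t (g : 'cV[int]_n) : pairing (y - t *: real_mx a) (real_mx g) =
    pairing y (real_mx g) - t * (ipair a g)%:~R.
  by rewrite pairBl pairZl pair_int.
split=> [yG|[t t0 yt] g]; last first.
  rewrite mem_cat mem_filter => /orP[/andP[ag gG]|/mapP[[g1 g2] /=]].
    have := yt g gG; rewrite pE subr_ge0; apply: le_trans.
    by rewrite mulr_ge0 // ler0z.
  move=> /allpairsP[[u u'] /= [+ + [-> ->]]] ->.
  rewrite !mem_filter => /andP[p1 /yt] + /andP[p2 /yt].
  rewrite !pE real_mxB !real_mxZ pairBr !pairZr.
  move: p1 p2; rewrite -(ltr0z R) -(ltrz0 R).
  move: (ipair a u)%:~R (ipair a u')%:~R => p q p0 q0 H1 H2.
  have := mulr_ge0 (ltW p0) H2; have : 0 <= (- q) * (pairing y (real_mx u) - t * p).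
    by rewrite mulr_ge0 // oppr_ge0 ltW.
  lra.
have yG1 g : g \in G -> 0 <= ipair a g -> 0 <= pairing y (real_mx g).
  by move=> gG ag; apply: yG; rewrite mem_cat mem_filter ag gG.
have yG2 g g' : g \in G -> g' \in G -> 0 < ipair a g -> ipair a g' < 0 ->
  pairing y (real_mx g') / (ipair a g')%:~R <= pairing y (real_mx g) / (ipair a g)%:~R.
  move=> gG gG' ag ag'.
  have : 0 <= pairing y (real_mx (ipair a g *: g' - ipair a g' *: g)).
    apply: yG; rewrite mem_cat; apply/orP; right; apply/mapP; exists (g, g') => //.
    by apply/allpairsP; exists (g, g'); rewrite !mem_filter ag ag' gG gG'.
  rewrite real_mxB !real_mxZ pairBr !pairZr => H.
  rewrite ler_ndivrMr ?ltrz0 // mulrAC ler_pdivrMr ?ltr0z //.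
  lra.
(* The largest lower bound; starting the maximum at 0 accounts for [0 <= t]. *)
pose f g : R := pairing y (real_mx g) / (ipair a g)%:~R.
pose t := \big[Num.max/0]_(g <- G | ipair a g < 0) f g.
exists t; first by rewrite /t; elim/big_rec: _ => // i x _ x0; rewrite le_max x0 orbT.
move=> g gG; rewrite pE subr_ge0.
have [ag|ag|ag] := ltgtP (ipair a g) 0.
- rewrite -ler_ndivrMr ?ltrz0 // /t.
  exact: (le_bigmax_seq _ g _ f gG ag).
- rewrite -ler_pdivlMr ?ltr0z // /t big_seq_cond.
  elim/big_rec: _ => [|g' u /andP[gG' ag'] uf].
    by rewrite divr_ge0 ?ler0z ?yG1 ?ltW.
  by rewrite ge_max uf andbT yG2.
- by rewrite ag mulr0 yG1 ?ag.
Qed.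

(** A finitely generated cone is polyhedral: adding a generator [a] means asking
    for some [t >= 0] with [y - t a] in the smaller cone, and [t] can be
    eliminated.  Integrality of the normals survives each elimination. *)
Theorem weyl n (s : seq 'rV[int]_n) : exists G : seq 'cV[int]_n,
  forall y : 'rV[R]_n,
    conic s y <-> forall g, g \in G -> 0 <= pairing y (real_mx g).
Proof.
elim: s => [|a s [G GP]].
  exists ([seq delta_mx i 0 | i <- enum 'I_n] ++ [seq - delta_mx i 0 | i <- enum 'I_n]).
  move=> y; split=> [[c [_ ->]]|H].
    by rewrite big_ord0 => g _; rewrite pair0l.
  exists (fun=> 0); split=> //; rewrite big_ord0.
  apply/rowP => i; rewrite mxE; apply/eqP.
  have pd : pairing y (real_mx (delta_mx i 0)) = y 0 i.
    by rewrite /real_mx map_delta_mx /pairing -colE mxE.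
  rewrite eq_le -oppr_ge0 -pd -pairNr -real_mxN !H ?mem_cat //; apply/orP.
    by left; apply/mapP; exists i; rewrite ?mem_enum.
  by right; apply/mapP; exists i; rewrite ?mem_enum.
exists (eliminate a G) => y; rewrite conic_cons eliminateP.
by split=> -[t t0 /GP]; exists t.
Qed.

(** It suffices to test nonnegativity at integral points, because the normals in
    [weyl] are integral and are themselves such points. *)
Lemma farkas n (s : seq 'rV[int]_n) (y : 'rV[R]_n) :
  (forall x : 'cV[int]_n, (forall a, a \in s -> 0 <= ipair a x) ->
    0 <= pairing y (real_mx x)) -> conic s y.
Proof.
have [G GP] := weyl s => H; apply/GP => g gG; apply: H => a /conic_mem/GP/(_ g gG).
by rewrite pair_int ler0z.
Qed.

(** The inner normals of the cone generated by [s] generate the dual cone; this is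
    [weyl] applied twice. *)
Theorem minkowski n (s : seq 'rV[int]_n) : exists G : seq 'cV[int]_n,
  (forall g, g \in G -> forall a, a \in s -> 0 <= ipair a g) /\
  forall x : 'cV[R]_n, (forall a, a \in s -> 0 <= dot a x) ->
    exists c : nat -> R, (forall i, 0 <= c i) /\
      x = \sum_(i < size G) c i *: real_mx G`_i.
Proof.
have [G GP] := weyl s.
have Gs g : g \in G -> forall a, a \in s -> 0 <= ipair a g.
  by move=> gG a /conic_mem/GP/(_ g gG); rewrite pair_int ler0z.
exists G; split=> // x sx.
have [H HP] := weyl [seq g^T | g <- G].
have : conic [seq g^T | g <- G] x^T.
  apply/HP => h hH; rewrite -[real_mx h]trmxK pair_tr.
  apply: conic_pair_ge0 sx _; apply/GP => g gG.
  have /HP/(_ h hH) := conic_mem (map_f trmx gG).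
  by rewrite -[X in pairing _ X]trmxK real_mx_tr pair_tr.
move=> [c [c0 e]]; exists c; split=> //.
rewrite -[LHS]trmxK e raddf_sum /= size_map; apply: eq_bigr => i _.
by rewrite linearZ /= -real_mx_tr (nth_map 0) // trmxK.
Qed.

End Cones.

(** * Linear programming duality *)

Local Notation const1 := (@const_mx _ 1 1).

Section LinearProgramming.
Variable R : realType.

Definition system n := seq ('rV[int]_n * int).

Definition sols n (S : system n) : set 'cV[R]_n :=
  [set x | forall p, p \in S -> dot p.1 x <= p.2%:~R].

Definition lhs n (S : system n) i : 'rV[R]_n := real_mx R (nth (0, 0) S i).1.
Definition rhs n (S : system n) i : R := (nth (0, 0) S i).2%:~R.

Lemma sols_nth n (S : system n) x i :
  sols S x -> (i < size S)%N -> pairing (lhs S i) x <= rhs S i.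
Proof. by move=> xS lt_i; apply: xS; rewrite mem_nth. Qed.

Lemma pair_comb_le n (S : system n) (y : nat -> R) x :
  (forall i, 0 <= y i) -> sols S x ->
  pairing (\sum_(i < size S) y i *: lhs S i) x <= \sum_(i < size S) y i * rhs S i.
Proof.
move=> y0 xS; rewrite pair_suml ler_sum // => i _.
by rewrite pairZl ler_wpM2l // sols_nth.
Qed.

(** An inequality [a x <= b] becomes the vector [(a, b)]; the vector [(0, 1)]
    stands for weakening the right-hand side. *)
Definition homog n (p : 'rV[int]_n * int) : 'rV[int]_(n + 1) :=
  row_mx p.1 (const1 p.2).

Lemma pair_homog n (y : 'rV[R]_n) c (u : 'cV[R]_n) t :
  pairing (row_mx y (const1 c)) (col_mx u (const1 t)) = pairing y u + c * t.
Proof. by rewrite /pairing mul_row_col mxE; congr (_ + _); rewrite mxE big_ord1 !mxE. Qed.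

Lemma col_split n (g : 'cV[int]_(n + 1)) :
  real_mx R g =
  col_mx (real_mx R (usubmx g)) (const1 (dsubmx g 0 0)%:~R).
Proof.
rewrite -[g in LHS]vsubmxK /real_mx map_col_mx; congr col_mx.
by apply/matrixP => i j; rewrite !mxE !ord1.
Qed.

Lemma real_homog n (p : 'rV[int]_n * int) :
  real_mx R (homog p) = row_mx (real_mx R p.1) (const1 p.2%:~R).
Proof. by rewrite /real_mx map_row_mx map_const_mx. Qed.

Lemma conic_homog n (S : system n) y c :
  conic [seq homog p | p <- (0, 1) :: S] (row_mx y (const1 c)) <->
  exists l : nat -> R, [/\ forall i, 0 <= l i,
    y = \sum_(i < size S) l i *: lhs S i & \sum_(i < size S) l i * rhs S i <= c].
Proof.
have E (l : nat -> R) :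
    \sum_(i < size [seq homog p | p <- S]) l i *: real_mx R (nth 0 [seq homog p | p <- S] i)
    = row_mx (\sum_(i < size S) l i *: lhs S i)
             (const1 (\sum_(i < size S) l i * rhs S i)).
  rewrite size_map.
  transitivity (\sum_(i < size S) row_mx (l i *: lhs S i) (const1 (l i * rhs S i))).
    apply: eq_bigr => i _; rewrite (nth_map (0, 0)) // real_homog scale_row_mx.
    by congr row_mx; apply/matrixP => a b; rewrite !mxE.
  apply/rowP=> b; rewrite summxE -(splitK b); case: (fintype.split b) => j /=.
    rewrite row_mxEl summxE; apply: eq_bigr => i _; exact: row_mxEl.
  rewrite row_mxEr mxE; apply: eq_bigr => i _; rewrite row_mxEr; exact: mxE.
have E2 t : row_mx y (const1 c) - t *: real_mx R (homog (0, 1)) =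
    row_mx y (const1 (c - t)) :> 'rV[R]_(n + 1).
  rewrite real_homog real_mx0 scale_row_mx scaler0 opp_row_mx add_row_mx oppr0 addr0.
  by congr row_mx; apply/matrixP => a b; rewrite !mxE mulr1.
split=> [/conic_cons[t t0 [l [l0]]]|[l [l0 yE le]]].
  rewrite E2 E => /eq_row_mx[-> /matrixP/(_ 0 0)]; rewrite !mxE => ec.
  by exists l; split=> //; rewrite -ec lerBlDr lerDl.
apply/conic_cons; exists (c - \sum_(i < size S) l i * rhs S i); first by rewrite subr_ge0.
by exists l; split=> //; rewrite E2 E yE subKr.
Qed.

(** If [(w, c)] were not in the cone, a point [(u, t)] with [t >= 0] would separate it.
    For [t > 0] the point [- u / t] satisfies the system and violates
    [w x <= c]; for [t = 0] the ray from [x0] in direction [- u] does so far out. *)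
Lemma farkas_affine n (S : system n) (x0 : 'cV[R]_n) w c :
  sols S x0 -> (forall x, sols S x -> pairing w x <= c) ->
  conic [seq homog p | p <- (0, 1) :: S] (row_mx w (const1 c)).
Proof.
move=> x0S wS; apply: farkas => g gK.
have := gK (homog (0, 1)) (mem_head _ _).
have pK p : p \in S -> 0 <= dot p.1 (real_mx R (usubmx g)) + p.2%:~R * (dsubmx g 0 0)%:~R.
  move=> pS; have := gK (homog p) _; rewrite inE map_f ?orbT // => /(_ isT).
  by rewrite -(ler0z R) -pair_int real_homog col_split pair_homog.
rewrite -(ler0z R) -pair_int real_homog col_split !pair_homog real_mx0 pair0l.
rewrite add0r mul1r; move: pK.
set u := real_mx R (usubmx g); set t : R := (dsubmx g 0 0)%:~R => pK.
rewrite le_eqVlt => /predU1P[t0|t0].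
  rewrite -t0 mulr0 addr0 leNgt; apply/negP => wu.
  (* The step length at which [w] exceeds [c] by 1 along the ray. *)
  pose s := (c - pairing w x0 + 1) / (- pairing w u).
  have s0 : 0 <= s by have := wS x0 x0S => ?; rewrite divr_ge0 //; lra.
  have := wS (x0 - s *: u); rewrite pairBr pairZr.
  have -> : s * pairing w u = - (c - pairing w x0 + 1).
    by rewrite /s -mulrA [_^-1 * _]mulrC invrN mulrN divff ?lt_eqF // mulrN1.
  move=> /(_ _); apply/not_implyP; split; last by apply/negP; rewrite -ltNge; lra.
  move=> p pS; rewrite dotE pairBr pairZr.
  have := pK p pS; rewrite -t0 mulr0 addr0 => /(mulr_ge0 s0); rewrite !dotE.
  have := x0S p pS; rewrite dotE; lra.
have xS : sols S (- t^-1 *: u).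
  move=> p pS; rewrite dotE pairZr mulNr lerNl mulrC ler_pdivlMr //.
  by have := pK p pS; rewrite dotE; lra.
have := wS _ xS; rewrite pairZr mulNr lerNl mulrC ler_pdivlMr //.
lra.
Qed.

(** The values [c] for which [w x <= c] is valid form a closed half-line, since by
    [weyl] membership of [(w, c)] in the cone of valid inequalities is given by
    finitely many linear conditions.  The condition that determines its end point
    also provides the optimal solution [x]. *)
Theorem lp_duality n (S : system n) (x0 : 'cV[R]_n) w c :
  sols S x0 -> (forall x, sols S x -> pairing w x <= c) ->
  exists (x : 'cV[R]_n) (l : nat -> R), [/\ sols S x, forall i, 0 <= l i,
    w = \sum_(i < size S) l i *: lhs S i &
    pairing w x = \sum_(i < size S) l i * rhs S i].
Proof.
move=> x0S wS; have wK := farkas_affine x0S wS.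
have [G GP] := weyl R [seq homog p | p <- (0, 1) :: S].
pose u i := real_mx R (usubmx (nth 0 G i)).
pose t i : R := (dsubmx (nth 0 G i) 0 0)%:~R.
have KP y e : conic [seq homog p | p <- (0, 1) :: S] (row_mx y (const1 e)) <->
    forall i, (i < size G)%N -> 0 <= pairing y (u i) + e * t i.
  rewrite GP; split=> [H i lt_i|H g /(nthP 0)[i lt_i <-]].
    by have := H _ (mem_nth 0 lt_i); rewrite col_split pair_homog.
  by rewrite col_split pair_homog H.
have t0 i : (i < size G)%N -> 0 <= t i.
  have : conic [seq homog p | p <- (0, 1) :: S] (real_mx R (homog (0, 1))).
    by apply: conic_mem; rewrite mem_head.
  rewrite real_homog real_mx0 /= => /KP H /H.
  by rewrite pair0l add0r mul1r.
(* Otherwise the conditions do not involve [c], and [w x <= w x0 - 1] would be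
   valid. *)
have [i0 ti0] : exists i : 'I_(size G), 0 < t i.
  apply: contrapT => /forallNP no.
  have tE i : (i < size G)%N -> t i = 0.
    move=> lt_i; apply/eqP; rewrite eq_le t0 // andbT leNgt; apply/negP.
    exact: (no (Ordinal lt_i)).
  have /conic_homog[l [l0 wE]] : conic [seq homog p | p <- (0, 1) :: S]
      (row_mx w (const1 (pairing w x0 - 1))).
    apply/KP => i lt_i; have /KP/(_ i lt_i) := wK.
    by rewrite tE // !mulr0.
  have := pair_comb_le l0 x0S; rewrite -wE; lra.
case: (@arg_maxP _ _ _ i0 (fun i : 'I_(size G) => 0 < t i)
        (fun i : 'I_(size G) => - pairing w (u i) / t i) ti0) => /= j tj jmax.
have xS : sols S (- (t j)^-1 *: u j).
  move=> p pS; rewrite dotE pairZr mulNr lerNl mulrC ler_pdivlMr //.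
  have : conic [seq homog p | p <- (0, 1) :: S] (real_mx R (homog p)).
    by apply: conic_mem; rewrite map_f // inE pS orbT.
  by rewrite real_homog => /KP/(_ j (ltn_ord j)); lra.
have /conic_homog[l [l0 wE le]] : conic [seq homog p | p <- (0, 1) :: S]
    (row_mx w (const1 (- pairing w (u j) / t j))).
  apply/KP => i lt_i.
  have := t0 i lt_i; rewrite le_eqVlt => /predU1P[ti|ti].
    by have /KP/(_ i lt_i) := wK; rewrite -ti !mulr0.
  have := jmax (Ordinal lt_i) ti; rewrite /= ler_pdivrMr //; lra.
exists (- (t j)^-1 *: u j), l; split=> //; apply/eqP; rewrite eq_le.
rewrite {1}wE pair_comb_le //= (le_trans le) //.
by rewrite pairZr mulNr mulNr mulrC.
Qed.

Lemma pair_max_attained n (S : system n) (x0 : 'cV[R]_n) w c :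
  sols S x0 -> (forall x, sols S x -> pairing w x <= c) ->
  exists2 x, sols S x & forall y, sols S y -> pairing w y <= pairing w x.
Proof.
move=> x0S wS; have [x [l [xS l0 wE wx]]] := lp_duality x0S wS.
by exists x => // y yS; rewrite wx {1}wE pair_comb_le.
Qed.

End LinearProgramming.

Arguments sols R [n] S.

(** * Bounded remainders of lattice points *)

Section LatticeSplitting.
Variable R : realType.

Lemma finite_box n (M : nat) : exists L : seq 'rV[int]_n,
  forall z : 'rV[int]_n, (forall j, `|z ord0 j| <= M%:Z) -> z \in L.
Proof.
exists [seq \row_j ((f j : nat)%:Z - M%:Z) | f : {ffun 'I_n -> 'I_(2 * M).+1}].
move=> z zM; apply/mapP.
exists [ffun j => inord (absz (z ord0 j + M%:Z))]; first by rewrite mem_enum.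
apply/rowP => j; rewrite !mxE ffunE.
by move: (zM j); move: (z ord0 j) => t tM; rewrite inordK; lia.
Qed.

(** Taking integer parts of the coefficients leaves a lattice point in a bounded
    region, hence one of finitely many remainders. *)
Lemma lattice_split n (s : seq 'rV[int]_n) : exists L : seq 'rV[int]_n,
  forall (h : 'rV[int]_n) (y : nat -> R), (forall i, 0 <= y i) ->
  real_mx R h = \sum_(i < size s) y i *: real_mx R s`_i ->
  exists k : nat -> nat, (forall i, 0 <= y i - (k i)%:R <= 1) /\
    h - \sum_(i < size s) s`_i *+ k i \in L.
Proof.
pose M : nat := (\sum_(i < size s) \sum_(j < n) absz (nth 0%R s i ord0 j))%N.
have [L LP] := finite_box n M.
exists L => h y y0 hE; exists (fun i => `|Num.floor (y i)|%N).
have kE i : `|Num.floor (y i)|%N%:R = (Num.floor (y i))%:~R :> R.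
  by rewrite natr_absz ger0_norm // floor_ge0.
have k01 i : 0 <= y i - `|Num.floor (y i)|%N%:R <= 1.
  rewrite kE subr_ge0 floor_le /= lerBlDr addrC.
  by have /andP[_ /ltW] := floor_itv (y i); rewrite intrD.
split=> //; apply: LP => j; rewrite -(ler_int R) intr_norm.
have -> : ((h - \sum_(i < size s) s`_i *+ `|Num.floor (y i)|%N) 0 j)%:~R =
    \sum_(i < size s) (y i - `|Num.floor (y i)|%N%:R) * (s`_i 0 j)%:~R :> R.
  transitivity ((real_mx R (h - \sum_(i < size s) s`_i *+ `|Num.floor (y i)|%N)) 0 j).
    by rewrite !mxE.
  rewrite real_mxB hE real_mx_sum -sumrB summxE; apply: eq_bigr => i _.
  by rewrite real_mxMn -scaler_nat -scalerBl !mxE.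
apply: le_trans (ler_norm_sum _ _ _) _.
rewrite /M -pmulrn natr_sum ler_sum // => i _.
rewrite normrM (bigD1 j) //= natrD.
have /andP[k0 k1] := k01 i; rewrite (ger0_norm k0).
apply: le_trans (ler_wpM2r (normr_ge0 _) k1) _.
by rewrite mul1r -intr_norm natr_absz lerDl.
Qed.

End LatticeSplitting.

(** * Rounds of Chvatal-Gomory cuts *)

Section Closure.
Variable R : realType.

(** All valid inequalities with integral normals are rounded, whatever their
    right-hand sides, so that no description of [X] is involved and [cg] is
    monotone in [X]. *)
Definition cg n (X : set 'cV[R]_n) : set 'cV[R]_n :=
  [set x | forall (h : 'rV[int]_n) (c : R),
    (forall y, X y -> dot h y <= c) -> dot h x <= (Num.floor c)%:~R].

Lemma floorDint (c : R) (k : int) : Num.floor (c + k%:~R) = Num.floor c + k.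
Proof.
apply: floor_def; have := floor_itv c; rewrite !intrD.
by move=> /andP[? ?]; apply/andP; split; lra.
Qed.

Lemma cg_mono n (X Y : set 'cV[R]_n) : X `<=` Y -> cg X `<=` cg Y.
Proof. by move=> XY x xX h c hc; apply: xX => y /XY/hc. Qed.

Lemma cg_int n (X : set 'cV[R]_n) (h : 'rV[int]_n) (d : int) x :
  (forall y, X y -> dot h y <= d%:~R) -> cg X x -> dot h x <= d%:~R.
Proof. by move=> hd /(_ h d%:~R hd); rewrite intrKfloor. Qed.

Lemma cg_sols_sub n (S : system n) : cg (sols R S) `<=` sols R S.
Proof. by move=> x xS p pS; apply: cg_int xS => y; apply. Qed.

Lemma cg0 n (X : set 'cV[R]_n) : X = set0 -> cg X = set0.
Proof.
move=> ->; apply/seteqP; split=> // x x0.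
have : dot 0 x <= (-1)%:~R by apply: (cg_int (X := set0)) x0.
by rewrite dotE real_mx0 pair0l ler0z.
Qed.

(** Finitely many cuts suffice: subtracting integer multiples of the inequalities
    of [S] from [h x <= c] changes [c] and its floor by the same integer, and leaves
    one of finitely many normals, for which the best bound is attained. *)
Lemma cg_sols n (S : system n) : exists S' : system n, cg (sols R S) = sols R S'.
Proof.
have [S0|/set0P[x0 x0S]] := eqVneq (sols R S) set0.
  exists [:: (0, -1)]; rewrite cg0 //; apply/seteqP; split=> // x /(_ _ (mem_head _ _)).
  by rewrite dotE real_mx0 pair0l ler0z.
pose bounded (h : 'rV[int]_n) := exists c : R, forall x, sols R S x -> dot h x <= c.
have /choice[f fP] : forall h, exists k : int, bounded h ->
    (forall x, cg (sols R S) x -> dot h x <= k%:~R) /\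
    forall c : R, (forall x, sols R S x -> dot h x <= c) -> k <= Num.floor c.
  move=> h.
  have [[c hc]|nb] := pselect (bounded h); last by exists 0.
  have [x xS xmax] := pair_max_attained x0S hc.
  exists (Num.floor (dot h x)) => _; split=> [y yS|e he]; first exact: yS.
  by rewrite le_floor // he.
have [L LP] := lattice_split R [seq p.1 | p <- S].
exists (S ++ [seq (h, f h) | h <- L & `[< bounded h >]]); apply/seteqP; split=> x xS.
  move=> p; rewrite mem_cat => /orP[pS|/mapP[h]]; first exact: (cg_sols_sub xS).
  by rewrite mem_filter => /andP[/asboolP/fP[fh _] _] ->; apply: fh.
move=> h c hc; have [y [l [yS l0 hE hy]]] := lp_duality (w := real_mx R h) x0S hc.
have [|k [k01 kL]] := LP h l l0.
  by rewrite hE size_map; apply: eq_bigr => i _; rewrite (nth_map (0, 0)).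
set h' := h - _ in kL.
pose K : int := \sum_(i < size S) (nth (0, 0) S i).2 *+ k i.
have h'E : real_mx R h' = \sum_(i < size S) (l i - (k i)%:R) *: lhs R S i.
  rewrite /h' real_mxB hE real_mx_sum size_map -sumrB; apply: eq_bigr => i _.
  by rewrite real_mxMn (nth_map (0, 0)) // -/(lhs R S i) -scaler_nat -scalerBl.
have h'c z : sols R S z -> dot h' z <= c - K%:~R.
  move=> zS; rewrite dotE h'E.
  apply: le_trans (pair_comb_le (y := fun i => l i - (k i)%:R) _ zS) _.
    by move=> i; have /andP[] := k01 i.
  have := hc y yS; rewrite dotE hy => le_c.
  rewrite -lerBDr opprK (le_trans _ le_c) // /K rmorph_sum -big_split ler_sum //= => i _.
  by rewrite rmorphMn /= -/(rhs R S i) -[rhs R S i *+ _]mulr_natl -mulrDl subrK.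
have bh' : bounded h' by exists (c - K%:~R).
have /fP[_ /(_ _ h'c)] := bh'.
rewrite -intrN floorDint.
rewrite -(ler_int R) => fle.
have xS' : sols R S x by move=> p pS; apply: xS; rewrite mem_cat pS.
have : dot h' x <= (f h')%:~R.
  by apply: (xS (h', f h')); rewrite mem_cat map_f ?orbT // mem_filter kL andbT; apply/asboolP.
have : dot h x - dot h' x <= K%:~R.
  rewrite dotE dotE -pairBl -real_mxB /h' subKr real_mx_sum pair_suml /K rmorph_sum size_map.
  rewrite ler_sum // => i _; rewrite (nth_map (0, 0)) // real_mxMn rmorphMn /=.
  rewrite -scaler_nat pairZl mulr_natl lerMn2r; apply/orP; right.
  exact: sols_nth.
move: fle; rewrite intrD intrN; lra.
Qed.

Lemma iter_cg_mono n k (X Y : set 'cV[R]_n) :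
  X `<=` Y -> iter k (@cg n) X `<=` iter k (@cg n) Y.
Proof. by move=> XY; elim: k => //= k IH; apply: cg_mono. Qed.

Lemma iter_cg_sols n k (S : system n) :
  exists S' : system n, iter k (@cg n) (sols R S) = sols R S'.
Proof. by elim: k => [|k /= [S' ->]]; [exists S|apply: cg_sols]. Qed.

Lemma iter_cg_antimono n k l (S : system n) : (k <= l)%N ->
  iter l (@cg n) (sols R S) `<=` iter k (@cg n) (sols R S).
Proof.
move=> /subnK <-; rewrite iterD; have [S' ->] := iter_cg_sols k S.
elim: (l - k)%N => //= j IH; apply: subset_trans IH.
by have [S'' ->] := iter_cg_sols j S'; apply: cg_sols_sub.
Qed.

End Closure.

(** * Cuts on faces *)

Section Faces.
Variable R : realType.

Definition slice n (X : set 'cV[R]_n) (w : 'rV[int]_n) (d : int) : set 'cV[R]_n :=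
  X `&` [set x | dot w x = d%:~R].

Lemma slice_sols n (S : system n) w d :
  slice (sols R S) w d = sols R ((w, d) :: (- w, - d) :: S).
Proof.
apply/seteqP; split=> x.
  move=> [xS wx] p; rewrite !inE => /or3P[/eqP->|/eqP->|/xS//] /=; first by rewrite wx.
  by rewrite dotE real_mxN pairNl -dotE wx intrN.
move=> H; split=> [p pS|/=]; first by apply: H; rewrite !inE pS !orbT.
apply/eqP; rewrite eq_le; apply/andP; split; first by apply: (H (w, d)); rewrite mem_head.
rewrite -lerN2 -pairNl -real_mxN -intrN.
by apply: (H (- w, - d)); rewrite !inE eqxx orbT.
Qed.

(** The maximum of [w] is attained, so it lies strictly below [d], and its floor is
    at most [d - 1]. *)
Lemma cg_lt n (S : system n) w (d : int) x :
  (forall y, sols R S y -> dot w y < d%:~R) ->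
  cg (sols R S) x -> dot w x <= (d - 1)%:~R.
Proof.
move=> wd xS.
have [S0|/set0P[x0 x0S]] := eqVneq (sols R S) set0; first by rewrite cg0 // in xS.
have [x1 x1S x1max] := pair_max_attained (w := real_mx R w) x0S (fun y yS => ltW (wd y yS)).
apply: le_trans (xS w _ x1max) _; rewrite ler_int.
have : Num.floor (dot w x1) < d by rewrite floor_lt_int wd.
rewrite dotE; lia.
Qed.

(** An inequality [h x <= c] valid on the face becomes valid on the whole
    polyhedron after adding a large integer multiple of [w x <= d].  The added
    right-hand side is an integer, so rounding does the same on both. *)
Lemma cg_slice n (S : system n) w d :
  (forall y, sols R S y -> dot w y <= d%:~R) ->
  slice (cg (sols R S)) w d `<=` cg (slice (sols R S) w d).
Proof.
move=> wd x [xS wx] h c hc.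
have [S0|/set0P[x0 x0S]] := eqVneq (slice (sols R S) w d) set0.
  have := cg_lt (d := d) (w := w) _ xS; rewrite wx ler_int => H.
  suff : d <= d - 1 by lia.
  apply: H => y yS; rewrite lt_neqAle wd // andbT; apply/eqP => wy.
  by have : slice (sols R S) w d y by []; rewrite S0.
move: x0S hc; rewrite slice_sols => x0S hc.
have [y [l [yS l0 hE hy]]] := lp_duality (w := real_mx R h) x0S hc.
move: (hc y yS) => {hc yS}; rewrite dotE hy => le_c; move: le_c hE.
rewrite /= !big_ord_recl /= /lhs /rhs /= real_mxN intrN => le_c hE.
(* [l 0] and [l 1] are the multipliers of the two inequalities that make up the
   equation [w x = d]; only the second one has to be compensated. *)
pose M := Num.floor (l 1%N) + 1.
have lM : l 1%N <= M%:~R by have /andP[_ /ltW] := floor_itv (l 1%N).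
have := xS (h + M *: w) (c + (M * d)%:~R); rewrite floorDint.
rewrite dotE real_mxD real_mxZ pairDl pairZl -!dotE wx intrD intrM lerD2r; apply=> z zS.
rewrite dotE real_mxD real_mxZ pairDl pairZl hE !pairDl !pairZl pairNl pair_suml.
have wz := wd z zS; rewrite dotE in wz.
have H : \sum_(i < size S) pairing (l (lift ord0 (lift ord0 i)) *: lhs R S i) z <=
    \sum_(i < size S) l (lift ord0 (lift ord0 i)) * rhs R S i.
  by rewrite ler_sum // => i _; rewrite pairZl ler_wpM2l // sols_nth.
have H2 : (l 0%N - l 1%N + M%:~R) * pairing (real_mx R w) z <=
    (l 0%N - l 1%N + M%:~R) * d%:~R.
  by rewrite ler_wpM2l //; have := l0 0%N; lra.
rewrite /lhs /rhs /= in le_c H H2 *.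
lra.
Qed.

Lemma iter_cg_slice n k (S : system n) w d :
  (forall y, sols R S y -> dot w y <= d%:~R) ->
  slice (iter k (@cg R n) (sols R S)) w d `<=` iter k (@cg R n) (slice (sols R S) w d).
Proof.
move=> wd; elim: k => //= k IH; apply: subset_trans (cg_mono IH).
have [S' E] := iter_cg_sols R k S; rewrite E; apply: cg_slice => y yS'; apply: wd.
by apply: (iter_cg_antimono (leq0n k)); rewrite E.
Qed.

(** Once the face [w x = d] has disappeared, one more round rounds the bound on
    [w] down to the next integer. *)
Lemma cg_descend n (S : system n) w d r :
  (forall y, sols R S y -> dot w y <= d%:~R) ->
  iter r (@cg R n) (slice (sols R S) w d) = set0 ->
  forall x, iter r.+1 (@cg R n) (sols R S) x -> dot w x <= (d - 1)%:~R.
Proof.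
move=> wd r0 x /=; have [S' E] := iter_cg_sols R r S; rewrite E; apply: cg_lt => y yS'.
rewrite lt_neqAle wd ?andbT; last by apply: (iter_cg_antimono (leq0n r)); rewrite E.
apply/eqP => wy.
have : iter r (@cg R n) (slice (sols R S) w d) y.
  by apply: iter_cg_slice => //; split=> //; rewrite E.
by rewrite r0.
Qed.

(** Iterated descent of the bound on [w]; the faces met on the way belong to the
    polyhedra reached so far, hence the quantification over [S']. *)
Lemma cg_push n (S : system n) w (c : R) (e : int) :
  (forall y, sols R S y -> dot w y <= c) ->
  (forall S' d, sols R S' `<=` sols R S -> e < d ->
    exists r, iter r (@cg R n) (slice (sols R S') w d) = set0) ->
  exists N, forall x, iter N (@cg R n) (sols R S) x -> dot w x <= e%:~R.
Proof.
move=> wc face.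
have step (j : nat) S' : sols R S' `<=` sols R S ->
    (forall y, sols R S' y -> dot w y <= (e + j%:Z)%:~R) ->
    exists N, forall x, iter N (@cg R n) (sols R S') x -> dot w x <= e%:~R.
  elim: j S' => [|j IH] S' S'S wS'; first by exists 0%N => x /wS'; rewrite addr0.
  have [|r r0] := face S' (e + j.+1%:Z) S'S; first by lia.
  have [S'' E] := iter_cg_sols R r.+1 S'.
  have S''S' : sols R S'' `<=` sols R S'.
    by rewrite -E; apply: (iter_cg_antimono (leq0n _)).
  have [||N HN] := IH S''; first exact: subset_trans S''S' S'S.
    move=> y; rewrite -E => /(cg_descend wS' r0).
    by rewrite (_ : e + j.+1%:Z - 1 = e + j%:Z) //; lia.
  by exists (N + r.+1)%N => x; rewrite iterD E; apply: HN.
have [S' E] := cg_sols R S.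
have S'S : sols R S' `<=` sols R S by rewrite -E; apply: cg_sols_sub.
have [|N HN] := step (absz (Num.floor c - e)) S' S'S.
  move=> y; rewrite -E => /(_ w c wc)/le_trans; apply; rewrite ler_int; lia.
by exists N.+1 => x; rewrite -[N.+1]addn1 iterD /= E; apply: HN.
Qed.

End Faces.

(** * Polyhedra without lattice points *)

Section Emptiness.
Variable R : realType.

Lemma diag_mulE (K : comNzRingType) m n (d : nat -> K) (v : 'cV[K]_n) (i : 'I_m) (j : 'I_n) :
  i = j :> nat ->
  ((\matrix_(i < m, j < n) (d i *+ (i == j :> nat))) *m v) i 0 = d i * v j 0.
Proof.
move=> ij; rewrite mxE (bigD1 j) //= mxE ij eqxx big1 ?addr0 // => k ne.
rewrite mxE (_ : (i == k :> nat) = false) ?mul0r //.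
by apply/negbTE; apply: contra ne => /eqP e; apply/eqP/val_inj; rewrite /= -e.
Qed.

Lemma diag_mul0 (K : comNzRingType) m n (d : nat -> K) (v : 'cV[K]_n) (i : 'I_m) :
  (n <= i)%N -> ((\matrix_(i < m, j < n) (d i *+ (i == j :> nat))) *m v) i 0 = 0.
Proof.
move=> le_ni; rewrite mxE big1 // => k _.
by rewrite mxE gtn_eqF ?mul0r // (leq_trans (ltn_ord k)).
Qed.

(** After a unimodular change of coordinates the equations are diagonal.  If
    [g y = f] has no integral solution, then the coordinate [y] is constantly
    [f / g], a non-integer, and two cuts contradict each other. *)
Lemma lattice_or_cut r n (E : 'M[int]_(r, n)) (e : 'cV[int]_r) :
  (exists z, E *m z = e) \/
  forall X : set 'cV[R]_n, (forall x, X x -> real_mx R E *m x = real_mx R e) ->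
    cg X = set0.
Proof.
have [L Lu [U Uu [d _ EE]]] := int_Smith_normal_form E.
set D := \matrix_(i, j) _ in EE.
have [f eE] : exists f, e = L *m f by exists (invmx L *m e); rewrite mulKVmx.
pose g (i : 'I_r) : int := if (i < n)%N then d`_i else 0.
have [H|nH] := pselect (forall i, (g i %| f i ord0)%Z).
  left.
  pose t : 'cV[int]_n := \col_j \sum_(i < r | i == j :> nat) (f i ord0 %/ g i)%Z.
  exists (invmx U *m t); rewrite EE eE -!mulmxA mulKVmx //; congr (L *m _).
  apply/colP => i; have := H i; rewrite /g; case: ltnP => lt_in; last first.
    by rewrite diag_mul0 // dvd0z => /eqP->.
  rewrite (@diag_mulE _ _ _ _ _ _ (Ordinal lt_in)) // [t _ _]mxE.
  rewrite (big_pred1 i) => [|k]; last by [].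
  by rewrite /g lt_in => /divzK; rewrite mulrC.
right=> X XE; move: nH => /existsNP[i ndv].
have XD x : X x -> (real_mx R D *m (real_mx R U *m x)) i 0 = (f i 0)%:~R.
  move=> /XE; rewrite EE eE !real_mxM -!mulmxA => /(congr1 (mulmx (real_mx R (invmx L)))).
  by rewrite !mulmxA -!real_mxM mulVmx // !mul1mx real_mxM -mulmxA => ->; rewrite mxE.
have DE : real_mx R D = \matrix_(i, j) ((d`_i)%:~R *+ (i == j :> nat)).
  by apply/matrixP => a b; rewrite !mxE rmorphMn.
apply/seteqP; split=> // x Xx.
have [X0|/set0P[x0 Xx0]] := eqVneq X set0; first by rewrite cg0 // in Xx.
have := XD x0 Xx0; rewrite DE; case: (ltnP i n) => lt_in; last first.
  rewrite (diag_mul0 (fun i => (d`_i)%:~R)) // => /eqP; rewrite eq_sym intr_eq0 => fi.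
  by case: ndv; rewrite /g ltnNge lt_in dvd0z.
pose j := Ordinal lt_in.
rewrite (@diag_mulE _ _ _ (fun i => (d`_i)%:~R) _ _ j) // => fE.
have di0 : (d`_i)%:~R != 0 :> R.
  rewrite intr_eq0; apply/eqP => di; case: ndv; rewrite /g lt_in di dvd0z.
  by move: fE; rewrite di mul0r => /eqP; rewrite eq_sym intr_eq0.
pose c : R := (f i 0)%:~R / (d`_i)%:~R.
have Uc y : X y -> dot (row j U) y = c.
  move=> /XD; rewrite DE (@diag_mulE _ _ _ (fun i => (d`_i)%:~R) _ _ j) //.
  move=> dU; rewrite /c -dU mulrAC divff // mul1r.
  by rewrite /dot map_row -row_mul mxE.
have c1 : dot (row j U) x <= (Num.floor c)%:~R by apply: Xx => y /Uc->.
have c2 : dot (- row j U) x <= (Num.floor (- c))%:~R.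
  by apply: Xx => y /Uc yc; rewrite dotE real_mxN pairNl -dotE yc.
rewrite dotE real_mxN pairNl -dotE in c2.
have c3 := floor_le c; have c4 := floor_le (- c).
have cE : (Num.floor c)%:~R = c by lra.
apply: ndv; rewrite /g lt_in; apply/dvdzP; exists (Num.floor c).
by apply: (@intr_inj R); rewrite intrM cE /c mulfVK.
Qed.

Lemma conic_bounded_below n (s : seq 'rV[int]_n) y (X : set 'cV[R]_n) :
  (forall a, a \in s -> exists b, forall x, X x -> b <= dot a x) -> conic s y ->
  exists b, forall x, X x -> b <= pairing y x.
Proof.
elim: s y => [|a s IH] y sX; first by move=> [c [_ ->]]; exists 0 => x _; rewrite big_ord0 pair0l.
move=> /conic_cons[t t0 /IH[|b bX]]; first by move=> b bs; apply: sX; rewrite inE bs orbT.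
have [b' bX'] := sX a (mem_head _ _).
exists (b + t * b') => x Xx; have := bX x Xx; rewrite pairBl pairZl.
by have := ler_wpM2l t0 (bX' x Xx); rewrite dotE; lra.
Qed.

(** The induction is on the dimension of the space of solutions of [E x = e].
    Consider the normals that are not constant on this space.  If all of them are
    negative in some direction of the space, lattice points exist far out in that
    direction.  Otherwise one of them, say [w], vanishes on the recession cone, so
    that [w] is bounded from both sides; its faces [w x = d] have smaller dimension,
    and the bound on [w] can be lowered below its minimum. *)
Theorem cg_empty n r (E : 'M[int]_(r, n)) (e : 'cV[int]_r) (S : system n) :
  (forall x, sols R S x -> real_mx R E *m x = real_mx R e) ->
  (forall z, ~ sols R S (real_mx R z)) ->
  exists N, iter N (@cg R n) (sols R S) = set0.
Proof.
have [k] := ubnP (n - \rank (real_mx R E)); elim: k => // k IH in r E e S *.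
rewrite ltnS => rk SE Sz.
have [S0|/set0P[x0 x0S]] := eqVneq (sols R S) set0; first by exists 0%N.
have [[z0 Ez0]|/(_ _ SE)] := lattice_or_cut E e; last by exists 1%N.
pose S' := [seq p <- S | ~~ (real_mx R p.1 <= real_mx R E)%MS].
pose s := [seq - p.1 | p <- S'] ++ [seq row i E | i <- enum 'I_r] ++
          [seq - row i E | i <- enum 'I_r].
have [G [Gs GP]] := minkowski R s.
have G1 g : g \in G -> forall p, p \in S' -> ipair p.1 g <= 0.
  move=> gG p pS'; have := Gs g gG (- p.1).
  rewrite /s mem_cat (map_f (fun p => - p.1)) // => /(_ isT).
  by rewrite /ipair mulNmx mxE oppr_ge0.
have G2 g : g \in G -> E *m g = 0.
  move=> gG; apply/colP => i; apply/eqP; rewrite [X in _ == X]mxE eq_le.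
  have <- : ipair (row i E) g = (E *m g) i 0 by rewrite /ipair -row_mul mxE.
  rewrite -oppr_ge0; apply/andP; split.
    have -> : - ipair (row i E) g = ipair (- row i E) g by rewrite /ipair mulNmx [RHS]mxE.
    apply: Gs => //; rewrite !mem_cat; apply/orP; right; apply/orP; right.
    by apply/mapP; exists i; rewrite ?mem_enum.
  apply: Gs => //; rewrite !mem_cat; apply/orP; right; apply/orP; left.
  by apply/mapP; exists i; rewrite ?mem_enum.
(* The sum of the generators lies in the relative interior of the recession cone. *)
pose u := \sum_(g <- G) g.
have uE w : ipair w u = \sum_(g <- G) ipair w g.
  by rewrite /ipair /u mulmx_sumr summxE.
have Eu : E *m u = 0 by rewrite mulmx_sumr big_seq big1.
have [allneg|] := pselect (forall p, p \in S' -> ipair p.1 u < 0).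
  (* Large enough to make up for the violation of any inequality at [z0]. *)
  pose t := (\sum_(p <- S') absz (ipair p.1 z0 - p.2))%N.
  case: (Sz (z0 + t%:Z *: u)) => p pS.
  have [pE|pE] := boolP (real_mx R p.1 <= real_mx R E)%MS.
    have [C pC] := submxP pE.
    have <- : dot p.1 x0 = dot p.1 (real_mx R (z0 + t%:Z *: u)); last exact: x0S.
    rewrite !dotE /pairing pC -!mulmxA SE // -real_mxM mulmxDr -scalemxAr Eu scaler0.
    by rewrite addr0 Ez0.
  have pS' : p \in S' by rewrite mem_filter pE.
  rewrite dotE pair_int ler_int /ipair mulmxDr -scalemxAr mxE [X in _ + X]mxE -/(ipair _ _).
  have -> : (p.1 *m u) 0 0 = ipair p.1 u by [].
  have := allneg p pS'.
  have : (absz (ipair p.1 z0 - p.2)%R <= t)%N by rewrite /t (big_rem p) //= leq_addr.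
  move: (ipair p.1 z0) (ipair p.1 u) p.2 t => a b q t; nia.
move=> /existsNP[p] /not_implyP[pS' /negP]; rewrite -leNgt => pu.
move: (pS'); rewrite mem_filter => /andP[pE pS].
have pG g : g \in G -> ipair p.1 g = 0.
  move=> gG; apply/eqP; rewrite eq_le G1 //=; move: pu.
  rewrite uE (big_rem g) //= => /le_trans; apply; rewrite gerDl big_seq sumr_le0 //.
  by move=> g' /mem_rem/G1; apply.
have pcone : conic s (real_mx R p.1).
  apply: farkas => x xs; have [|c [_ ->]] := GP (real_mx R x).
    by move=> a /xs; rewrite dotE pair_int ler0z.
  rewrite pair_sumr big1 // => i _; rewrite pairZr pair_int pG ?mulr0 //.
  exact: mem_nth.
have [|b bS] := conic_bounded_below (X := sols R S) _ pcone.
  move=> a; rewrite /s !mem_cat => /or3P[]/mapP.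
  - move=> [q]; rewrite mem_filter => /andP[_ qS] ->; exists (- q.2%:~R) => x xS.
    by rewrite dotE real_mxN pairNl lerN2 -dotE; apply: xS.
  - move=> [i _ ->]; exists ((e i 0)%:~R) => x /SE /matrixP/(_ i 0).
    by rewrite [RHS]mxE => <-; rewrite /dot map_row -row_mul [X in _ <= X]mxE.
  - move=> [i _ ->]; exists (- (e i 0)%:~R) => x /SE /matrixP/(_ i 0).
    rewrite [RHS]mxE => <-; rewrite dotE real_mxN pairNl lerN2.
    by rewrite /pairing /real_mx map_row -row_mul [X in X <= _]mxE.
have [||N HN] := @cg_push R n S p.1 p.2%:~R (Num.floor b - 1).
- by move=> y; apply.
- move=> S1 d S1S _; rewrite slice_sols.
  apply: (IH _ (col_mx E p.1) (col_mx e (const_mx d))).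
  + have : (real_mx R E < real_mx R (col_mx E p.1))%MS.
      rewrite /real_mx map_col_mx -!/(real_mx R _); apply/andP; split.
        by rewrite -addsmxE addsmxSl.
      by apply: contra pE; apply: submx_trans; rewrite -addsmxE addsmxSr.
    rewrite ltmxErank => /andP[_ rlt].
    have := rank_leq_col (real_mx R (col_mx E p.1)); move: rk rlt; lia.
  + rewrite -slice_sols => x [/S1S/SE xE px].
    rewrite /real_mx !map_col_mx mul_col_mx -!/(real_mx R _) xE; congr col_mx.
    by apply/matrixP => i j; rewrite !ord1 !(mxE, big_ord1) -px /dot /= !mxE.
  + by move=> z; rewrite -slice_sols => -[/S1S/Sz].
exists N; apply/seteqP; split=> // x xN.
have := HN x xN; have := bS x (iter_cg_antimono (leq0n N) xN).
rewrite -dotE intrB => b1 b2; have := floor_le b; lra.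
Qed.

End Emptiness.

(** * Hilbert bases *)

Lemma ipairNl n (h : 'rV[int]_n) z : ipair (- h) z = - ipair h z.
Proof. by rewrite /ipair mulNmx mxE. Qed.

Lemma ipair0l n z : ipair (0 : 'rV[int]_n) z = 0.
Proof. by rewrite /ipair mul0mx mxE. Qed.

Section Hilbert.
Variable R : realType.

Lemma conicD n (s : seq 'rV[int]_n) (y z : 'rV[R]_n) :
  conic s y -> conic s z -> conic s (y + z).
Proof.
move=> [c [c0 ->]] [d [d0 ->]]; exists (fun i => c i + d i).
split=> [i|]; first exact: addr_ge0.
by rewrite -big_split; apply: eq_bigr => i _; rewrite scalerDl.
Qed.

Lemma conicZ n (s : seq 'rV[int]_n) (t : R) (y : 'rV[R]_n) :
  0 <= t -> conic s y -> conic s (t *: y).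
Proof.
move=> t0 [c [c0 ->]]; exists (fun i => t * c i).
split=> [i|]; first exact: mulr_ge0.
by rewrite scaler_sumr; apply: eq_bigr => i _; rewrite scalerA.
Qed.

Lemma conic_0 n (s : seq 'rV[int]_n) : conic s (0 : 'rV[R]_n).
Proof. by exists (fun=> 0); split=> //; rewrite big1 // => i _; rewrite scale0r. Qed.

Lemma conic_sum n (s : seq 'rV[int]_n) I (r : seq I) (P : pred I) (F : I -> 'rV[R]_n) :
  (forall i, P i -> conic s (F i)) -> conic s (\sum_(i <- r | P i) F i).
Proof. by move=> sF; elim/big_ind: _ => //; [apply: conic_0|apply: conicD]. Qed.

(** The multiplicities are a function of the vectors, as in [hilbert_basis]. *)
Definition natcomb n (H : seq 'rV[int]_n) (z : 'rV[int]_n) : Prop :=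
  exists c : 'rV[int]_n -> nat, z = \sum_(h <- H) h *+ c h.

Lemma natcomb0 n (H : seq 'rV[int]_n) : natcomb H 0.
Proof. by exists (fun=> 0%N); rewrite big1. Qed.

Lemma natcombD n (H : seq 'rV[int]_n) y z :
  natcomb H y -> natcomb H z -> natcomb H (y + z).
Proof.
move=> [c ->] [d ->]; exists (fun h => c h + d h)%N.
by rewrite -big_split; apply: eq_bigr => h _; rewrite mulrnDr.
Qed.

Lemma natcombMn n (H : seq 'rV[int]_n) y k : natcomb H y -> natcomb H (y *+ k).
Proof.
by move=> Hy; elim: k => [|k IH]; [apply: natcomb0|rewrite mulrS; apply: natcombD].
Qed.

Lemma natcomb_mem n (H : seq 'rV[int]_n) h : uniq H -> h \in H -> natcomb H h.
Proof.
move=> uH hH; exists (fun x => (x == h : nat)).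
by rewrite (bigD1_seq h) //= eqxx big1 ?addr0 // => x /negPf->.
Qed.

(** The generators together with the finitely many bounded remainders in the cone
    generate all of its lattice points. *)
Lemma hilbert_finite n (s : seq 'rV[int]_n) : exists H : {fset 'rV[int]_n},
  (forall h, h \in H -> conic s (real_mx R h)) /\
  forall z, conic s (real_mx R z) -> natcomb H z.
Proof.
have [L LP] := lattice_split R s.
pose H : {fset 'rV[int]_n} := [fset h in s ++ [seq h <- L | `[< conic s (real_mx R h) >]]]%fset.
have HE h : (h \in H) = (h \in s) || ((`[< conic s (real_mx R h) >]) && (h \in L)).
  by rewrite /H in_fset mem_cat mem_filter.
exists H; split=> [h|z [y [y0 zE]]].
  by rewrite HE => /orP[/conic_mem//|/andP[/asboolP]].
have [k [k01 kL]] := LP z y y0 zE.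
set f := z - _ in kL.
have -> : z = f + \sum_(i < size s) s`_i *+ k i by rewrite subrK.
apply: natcombD.
  apply: natcomb_mem => //; first exact: fset_uniq.
  rewrite HE kL andbT; apply/orP; right; apply/asboolP.
  exists (fun i => y i - (k i)%:R); split=> [i|]; first by have /andP[] := k01 i.
  rewrite /f real_mxB zE real_mx_sum -sumrB; apply: eq_bigr => i _.
  by rewrite real_mxMn -scaler_nat -scalerBl.
elim/big_ind: _ => [||i _]; [exact: natcomb0|exact: natcombD|].
apply/natcombMn/natcomb_mem; first exact: fset_uniq.
by rewrite HE mem_nth.
Qed.

End Hilbert.

(** * Integer hulls *)

Section IntegerHull.
Variable R : realType.

Lemma conv_convex n (X : set 'cV[R]_n) x y t :
  0 <= t <= 1 -> conv X x -> conv X y -> conv X (t *: x + (1 - t) *: y).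
Proof.
move=> /andP[t0 t1] [k [p [c [pX c0 c1 ->]]]] [l [q [d [qX d0 d1 ->]]]].
exists (k + l)%N, (fun i => match fintype.split i with inl a => p a | inr b => q b end),
  (fun i => match fintype.split i with inl a => t * c a | inr b => (1 - t) * d b end).
split=> [i|i||].
- by case: fintype.split.
- by case: fintype.split => j; rewrite mulr_ge0 // subr_ge0.
- rewrite big_split_ord /=.
  under eq_bigr do rewrite (unsplitK (inl _ _)).
  under [X in _ + X]eq_bigr do rewrite (unsplitK (inr _ _)).
  by rewrite -!mulr_sumr c1 d1 !mulr1 addrC subrK.
- rewrite big_split_ord /= !scaler_sumr.
  under [X in _ = X + _]eq_bigr do rewrite (unsplitK (inl _ _)).
  under [X in _ = _ + X]eq_bigr do rewrite (unsplitK (inr _ _)).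
  by congr (_ + _); apply: eq_bigr => i _; rewrite scalerA.
Qed.

(** A point of the ray lies between [x] and a far point of the convex hull that is
    reached by an integral number of steps [g]. *)
Lemma conv_ray n (X : set 'cV[R]_n) (g : 'cV[R]_n) x t :
  (forall p, X p -> X (p + g)) -> 0 <= t -> conv X x -> conv X (x + t *: g).
Proof.
move=> Xg t0 cx.
pose N := (absz (Num.floor t)).+1.
have tN : t <= N%:R.
  rewrite /N -addn1 natrD natr_absz ger0_norm ?floor_ge0 //.
  by have /andP[_ /ltW] := floor_itv t; rewrite intrD.
have N0 : 0 < N%:R :> R by rewrite ltr0n.
have cN : conv X (x + N%:R *: g).
  case: cx => k [p [c [pX c0 c1 ->]]].
  exists k, (fun i => p i + N%:R *: g), c; split=> // [i|].
    rewrite scaler_nat; elim: N {tN N0} => [|j IH]; first by rewrite mulr0n addr0.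
    by rewrite mulrSr addrA; apply: Xg.
  under [RHS]eq_bigr do rewrite scalerDr.
  by rewrite big_split /= -scaler_suml c1 scale1r.
have -> : x + t *: g = (t / N%:R) *: (x + N%:R *: g) + (1 - t / N%:R) *: x.
  rewrite scalerDr scalerA mulfVK ?gt_eqF // scalerBl scale1r.
  by rewrite addrAC [X in _ = X + _]addrC subrK.
by apply: conv_convex => //; rewrite divr_ge0 ?ler0n //= ler_pdivrMr // mul1r.
Qed.

(** A lattice point [z] of the polyhedron corresponds to the lattice point [(z, 1)]
    of the homogenized cone.  In a decomposition of [(z, 1)] over a Hilbert basis of
    that cone, only elements with last coordinate 0 or 1 occur: lattice points of
    the polyhedron and integral recession directions.  The cone that these elements
    generate is polyhedral, and its inequalities, read at last coordinate 1,
    describe the integer hull. *)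
Theorem integer_hull_finite n (S : system n) z1 : sols R S (real_mx R z1) ->
  exists M : system n,
    (forall p z, p \in M -> sols R S (real_mx R z) -> ipair p.1 z <= p.2) /\
    sols R M `<=` integer_hull (sols R S).
Proof.
move=> z1S.
pose s := (row_mx 0 (const1 1)) :: [seq row_mx (- p.1) (const1 p.2) | p <- S].
have [G [Gs GP]] := minkowski R s.
have [H [HG HP]] := hilbert_finite R [seq g^T | g <- G].
pose ht (h : 'rV[int]_(n + 1)) : int := rsubmx h 0 0.
have hE (h : 'rV[int]_(n + 1)) : h = row_mx (lsubmx h) (const1 (ht h)).
  rewrite -[LHS]hsubmxK; congr row_mx; apply/matrixP => i j.
  by rewrite !ord1 [RHS]mxE.
have Hs h a : h \in H -> a \in s -> 0 <= ipair a h^T.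
  have trE (u v : 'rV[int]_(n + 1)) : pairing (real_mx R u) (real_mx R v)^T = (ipair v u^T)%:~R.
    by rewrite -pair_int real_mx_tr -[in RHS]pair_tr trmxK.
  move=> hH a_s; rewrite -(ler0z R) -trE; apply: conic_pair_ge0 (HG h hH) => _ /mapP[g gG ->].
  by rewrite dotE trE trmxK ler0z Gs.
have pairs (u : 'rV[int]_n) b (h : 'rV[int]_(n + 1)) :
    ipair (row_mx u (const1 b)) h^T = ipair u (lsubmx h)^T + b * ht h.
  rewrite {1}(hE h) tr_row_mx /ipair mul_row_col mxE; congr (_ + _).
  by rewrite mxE big_ord1 !mxE.
have ht0 h : h \in H -> 0 <= ht h.
  move=> hH; have := Hs h _ hH (mem_head _ _); rewrite pairs mul1r.
  by rewrite ipair0l add0r.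
have hrec h p : h \in H -> p \in S -> ipair p.1 (lsubmx h)^T <= p.2 * ht h.
  move=> hH pS; have := Hs h (row_mx (- p.1) (const1 p.2)) hH.
  rewrite pairs ipairNl inE (map_f (fun p => row_mx (- p.1) (const1 p.2))) //.
  by rewrite orbT addrC subr_ge0; apply.
pose H' := [seq h <- H | ht h <= 1].
have [W WP] := weyl R H'.
exists [seq (- (usubmx w)^T, dsubmx w 0 0) | w <- W].
have WE (x : 'cV[R]_n) w :
    pairing (row_mx x^T (const1 1)) (real_mx R w) =
    (dsubmx w 0 0)%:~R - dot (- (usubmx w)^T) x.
  rewrite col_split pair_homog mul1r dotE real_mxN pairNl opprK addrC; congr (_ + _).
  by rewrite real_mx_tr -pair_tr trmxK.
split.
  move=> _ z /mapP[w wW ->] zS; rewrite -(ler_int R) /= -subr_ge0 -pair_int -dotE -WE.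
  pose zz := row_mx z^T (const1 1).
  have zzE : real_mx R zz = row_mx (real_mx R z)^T (const1 1).
    by rewrite /real_mx map_row_mx map_const_mx map_trmx.
  rewrite -zzE; move: w wW; apply/WP.
  have /HP[c zc] : conic [seq g^T | g <- G] (real_mx R zz).
    have [|c [c0 zc]] := GP (real_mx R zz^T).
      move=> a; rewrite inE dotE pair_int ler0z => /predU1P[->|/mapP[p pS ->]].
        by rewrite pairs /zz row_mxKl /ht row_mxKr mxE ipair0l.
      rewrite pairs /zz row_mxKl trmxK /ht row_mxKr mxE mulr1 ipairNl.
      by have := zS p pS; rewrite dotE pair_int ler_int addrC subr_ge0.
    exists c; split=> //; rewrite -[LHS]trmxK -real_mx_tr zc raddf_sum /= size_map.
    by apply: eq_bigr => i _; rewrite linearZ /= -real_mx_tr (nth_map 0).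
  have htsum : \sum_(h <- H) ht h *+ c h = 1.
    transitivity (ht zz); last by rewrite /ht /zz row_mxKr mxE.
    rewrite zc /ht raddf_sum summxE; apply: eq_bigr => h _.
    by rewrite raddfMn mulmxnE.
  rewrite zc real_mx_sum big_seq; apply: conic_sum => h hH.
  rewrite real_mxMn; have [->|ch] := posnP (c h); first by rewrite mulr0n; apply: conic_0.
  rewrite -scaler_nat; apply: conicZ => //; apply: conic_mem.
  rewrite mem_filter hH andbT; move: htsum.
  rewrite (big_rem h) //=; set r := \sum_(_ <- _) _.
  have : 0 <= r by rewrite /r big_seq sumr_ge0 // => h' /mem_rem/ht0 h0; rewrite mulrn_wge0.
  have := ht0 h hH; rewrite -mulr_natr => ? ? ?; nia.
move=> x xM.
have : conic H' (row_mx x^T (const1 1)).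
  apply/WP => w wW; rewrite WE subr_ge0.
  by apply: (xM (_, _)); apply/mapP; exists w.
move=> [c [c0 E]].
pose X := sols R S `&` @int_points R n.
pose v i := real_mx R (lsubmx (nth 0 H' i))^T.
pose t i := ht (nth 0 H' i).
have t01 i : (i < size H')%N -> t i = 0 \/ t i = 1.
  move=> /(mem_nth 0); rewrite mem_filter => /andP[h1 /ht0]; rewrite -/(t i) in h1 *.
  by rewrite /t in h1 *; lia.
have HS i : (i < size H')%N -> nth 0 H' i \in H.
  by move=> /(mem_nth 0); rewrite mem_filter => /andP[].
have [xE cE] : x = \sum_(i < size H') c i *: v i /\ 1 = \sum_(i < size H') c i * (t i)%:~R.
  split.
    move/(congr1 (fun y => (lsubmx y)^T)): E; rewrite row_mxKl trmxK => ->.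
    rewrite !raddf_sum; apply: eq_bigr => i _.
    rewrite /v real_mx_tr /real_mx map_lsubmx -linearZ; congr (_^T).
    by apply/matrixP => a b; rewrite !mxE.
  move/(congr1 (fun y : 'rV_(n + 1) => rsubmx y 0 0)): E; rewrite row_mxKr mxE => E1.
  rewrite [LHS]E1 raddf_sum summxE; apply: eq_bigr => i _.
  by rewrite /t /ht /real_mx !mxE.
rewrite xE (bigID (fun i : 'I__ => t i == 1)) /=.
(* Elements of height 1 form a convex combination; the height 0 elements are then
   added one at a time. *)
have base : conv X (\sum_(i < size H' | t i == 1) c i *: v i).
  exists (size H'), (fun i => if t i == 1 then v i else real_mx R z1),
     (fun i => if t i == 1 then c i else 0); split=> [i|i||].
  - case: eqP => ti; last by split=> //; exists z1.
    split; last by exists (lsubmx (nth 0 H' i))^T.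
    move=> p pS; rewrite dotE /v pair_int ler_int.
    by have := hrec _ p (HS i (ltn_ord i)) pS; rewrite -/(t i) ti mulr1.
  - by case: ifP.
  - rewrite -big_mkcond cE [RHS](bigID (fun i : 'I__ => t i == 1)) /= [X in _ = _ + X]big1.
      by rewrite addr0; apply: eq_bigr => i /eqP->; rewrite mulr1.
    move=> i ti; have [->|t1] := t01 i (ltn_ord i); first by rewrite mulr0.
    by rewrite t1 in ti.
  - rewrite big_mkcond; apply: eq_bigr => i _; case: ifP => // _.
    by rewrite scale0r.
move: base; set x1 := \sum_(i < _ | _ == 1) _ => base.
elim/big_rec: (\sum_(i < _ | _) _) => [|i y ti cy]; first by rewrite addr0.
rewrite addrCA addrC; apply: conv_ray => // p [pS [z pz]].
have t0 : t i = 0 by have [|t1] := t01 i (ltn_ord i) => //; rewrite t1 in ti.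
split.
  move=> q qS; rewrite dotE pairDr /v pair_int.
  have := hrec _ q (HS i (ltn_ord i)) qS; rewrite -/(t i) t0 mulr0 -(lerz0 R).
  by have := pS q qS; rewrite dotE; lra.
by exists (z + (lsubmx (nth 0 H' i))^T); rewrite pz -!/(real_mx R _) real_mxD.
Qed.

(** A functional that increases along an integral recession direction is unbounded
    on the lattice points of the polyhedron. *)
Lemma bounded_of_lattice n (S : system n) z1 (w : 'rV[int]_n) (d : int) :
  sols R S (real_mx R z1) ->
  (forall z, sols R S (real_mx R z) -> ipair w z <= d) ->
  exists c : R, forall x, sols R S x -> dot w x <= c.
Proof.
move=> z1S wd.
have wcone : conic [seq p.1 | p <- S] (real_mx R w).
  apply: farkas => g gS; rewrite pair_int ler0z leNgt; apply/negP => wg.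
  pose t := absz (ipair w z1 - d)%R.
  have zS : sols R S (real_mx R (z1 - t.+1%:Z *: g)).
    move=> p pS; rewrite real_mxB real_mxZ dotE pairBr pairZr !pair_int.
    have := gS p.1 (map_f _ pS); rewrite -(ler0z R) => /(mulr_ge0 (ler0n R t.+1)).
    by have := z1S p pS; rewrite dotE pair_int -[t.+1%:~R]/(t.+1%:R); lra.
  have := wd _ zS.
  have -> : ipair w (z1 - t.+1%:Z *: g) = ipair w z1 - t.+1%:Z * ipair w g.
    by rewrite /ipair mulmxBr -scalemxAr !mxE.
  have : t.+1%:Z * (ipair w g + 1) <= 0 by apply: mulr_ge0_le0 => //; lia.
  by rewrite mulrDr mulr1 /t; lia.
have [|b bX] := conic_bounded_below (X := [set x | sols R S (- x)]) _ wcone.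
  move=> _ /mapP[p pS ->]; exists (- p.2%:~R) => x /(_ p pS).
  by rewrite !dotE pairNr lerNl.
exists (- b) => x xS; have := bX (- x); rewrite /= opprK => /(_ xS).
by rewrite pairNr lerNr.
Qed.

(** Each of the finitely many inequalities of the integer hull is reached by
    descent, because the faces above it contain no lattice points. *)
Theorem cg_finite n (S : system n) z1 : sols R S (real_mx R z1) ->
  exists N, iter N (@cg R n) (sols R S) `<=` integer_hull (sols R S).
Proof.
move=> z1S; have [M [MP MS]] := integer_hull_finite z1S.
suff [N NM] : exists N, iter N (@cg R n) (sols R S) `<=` sols R M.
  by exists N; apply: subset_trans MS.
elim: M MP {MS} => [|p M IH] MP; first by exists 0%N => x _ p.
have [|N NM] := IH; first by move=> q z qM; apply: MP; rewrite inE qM orbT.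
have [c wc] := bounded_of_lattice z1S (fun z => MP p z (mem_head _ _)).
have [S' d S'S ltd|N' pN'] := @cg_push R n S p.1 c p.2 wc.
  rewrite slice_sols; apply: (@cg_empty R n 0 0 0) => [x _|z].
    by apply/matrixP => -[].
  rewrite -slice_sols => -[/S'S zS]; rewrite /= dotE pair_int => /eqP.
  by rewrite eqr_int => /eqP pz; have := MP p z (mem_head _ _) zS; rewrite pz leNgt ltd.
exists (maxn N N') => x xN q; rewrite inE => /predU1P[->|qM].
  by apply: pN'; apply: iter_cg_antimono xN; apply: leq_maxr.
by apply: NM qM; apply: iter_cg_antimono xN; apply: leq_maxl.
Qed.

End IntegerHull.

(** * A bound that holds for all right-hand sides *)

Section Uniform.
Variable R : realType.

Lemma uniform_bound (T : finType) (P : T -> nat -> Prop) :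
  (forall t N N', (N <= N')%N -> P t N -> P t N') -> (forall t, exists N, P t N) ->
  exists N, forall t, P t N.
Proof.
move=> mono /choice[f fP]; exists (\max_t f t)%N => t.
exact: mono (leq_bigmax t) (fP t).
Qed.

Lemma conv_le n (X : set 'cV[R]_n) (w : 'rV[int]_n) (d : R) x :
  (forall p, X p -> dot w p <= d) -> conv X x -> dot w x <= d.
Proof.
move=> wd [k [p [c [pX c0 c1 ->]]]]; rewrite dotE pair_sumr -[d]mul1r -c1 mulr_suml.
by rewrite ler_sum // => i _; rewrite pairZr ler_wpM2l // wd.
Qed.

Definition subsystem m n (A : 'M[int]_(m, n)) (b : 'cV[int]_m) (T : {set 'I_m}) :
  system n := [seq (row i A, b i 0) | i <- enum T].

Lemma sols_subsystem m n (A : 'M[int]_(m, n)) b (T : {set 'I_m}) (x : 'cV[R]_n) :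
  sols R (subsystem A b T) x <-> forall i, i \in T -> dot (row i A) x <= (b i 0)%:~R.
Proof.
split=> [H i iT|H _ /mapP[i iT ->]]; last by apply: H; rewrite mem_enum in iT.
by apply: (H (row i A, b i 0)); apply/mapP; exists i; rewrite ?mem_enum.
Qed.

Lemma QbE m n (A : 'M[int]_(m, n)) b : Qb (R := R) A b = sols R (subsystem A b [set: 'I_m]).
Proof.
apply/seteqP; split=> x.
  by move=> H; apply/sols_subsystem => i _; have := H i; rewrite mxE.
by move=> /sols_subsystem H i; rewrite mxE; apply: H; rewrite inE.
Qed.

(** Fix the signs of the entries of [A (v - z)].  Then [v - z] is a conic combination
    of the integral generators of a cone that depends on the signs only.  Adding
    to [z] the integer parts of this combination moves every row monotonically from
    its value at [z] towards its value at [v], and stops at a distance from [v]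
    bounded by the generators.  There are finitely many sign patterns. *)
Lemma proximity m n (A : 'M[int]_(m, n)) : exists D : nat,
  forall (v : 'cV[R]_n) (z : 'cV[int]_n), exists z' : 'cV[int]_n, forall i,
    [/\ dot (row i A) (real_mx R z') <= dot (row i A) v + D%:R,
        dot (row i A) (real_mx R z) <= dot (row i A) v ->
          dot (row i A) (real_mx R z) <= dot (row i A) (real_mx R z') <= dot (row i A) v &
        dot (row i A) v < dot (row i A) (real_mx R z) ->
          dot (row i A) (real_mx R z') <= dot (row i A) (real_mx R z)].
Proof.
pose good (s : {ffun 'I_m -> bool}) (D : nat) :=
  forall (v : 'cV[R]_n) (z : 'cV[int]_n),
  (forall i, if s i then dot (row i A) (real_mx R z) <= dot (row i A) v
             else dot (row i A) v <= dot (row i A) (real_mx R z)) ->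
  exists z' : 'cV[int]_n, forall i,
    dot (row i A) (real_mx R z') <= dot (row i A) v + D%:R /\
    if s i
    then dot (row i A) (real_mx R z) <= dot (row i A) (real_mx R z') <= dot (row i A) v
    else dot (row i A) (real_mx R z') <= dot (row i A) (real_mx R z).
suff [D DP] : exists D, forall s, good s D.
  exists D => v z.
  have [|z' z'P] := DP [ffun i => dot (row i A) (real_mx R z) <= dot (row i A) v] v z.
    by move=> i; rewrite ffunE; case: leP => // /ltW.
  exists z' => i; have [zD] := z'P i; rewrite ffunE => zs; split=> // zv.
    by move: zs; rewrite zv.
  by move: zs; rewrite leNgt zv.
apply: uniform_bound => [s D D' leD sD v z /sD[z' z'P]|s].
  exists z' => i; have [zD zs] := z'P i; split=> //.
  by apply: le_trans zD _; rewrite lerD2l ler_nat.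
pose sgn i : 'rV[int]_n := if s i then row i A else - row i A.
have [G [Gs GP]] := minkowski R [seq sgn i | i <- enum 'I_m].
have sgnG i g : g \in G -> 0 <= ipair (sgn i) g.
  by move=> gG; apply: Gs => //; apply: map_f; rewrite mem_enum.
exists (\sum_(j < size G) \sum_(i < m) absz (ipair (row i A) (nth 0%R G j)))%N => v z zs.
have [|c [c0 vE]] := GP (v - real_mx R z).
  move=> _ /mapP[i _ ->]; have := zs i; rewrite /sgn; case: (s i) => H.
    by rewrite dotE pairBr subr_ge0.
  by rewrite dotE real_mxN pairNl pairBr opprB subr_ge0.
pose k j := absz (Num.floor (c j)).
have k01 j : 0 <= c j - (k j)%:R <= 1.
  rewrite /k natr_absz ger0_norm ?floor_ge0 // subr_ge0 floor_le lerBlDr addrC.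
  by have /andP[_ /ltW] := floor_itv (c j); rewrite intrD.
pose z' := z + \sum_(j < size G) nth 0 G j *+ k j.
have z'z (y : 'rV[R]_n) : pairing y (real_mx R z') - pairing y (real_mx R z) =
    \sum_(j < size G) (k j)%:R * pairing y (real_mx R (nth 0 G j)).
  rewrite -pairBr -real_mxB /z' addrC addKr real_mx_sum pair_sumr.
  by apply: eq_bigr => j _; rewrite real_mxMn -scaler_nat pairZr.
have vz' (y : 'rV[R]_n) : pairing y v - pairing y (real_mx R z') =
    \sum_(j < size G) (c j - (k j)%:R) * pairing y (real_mx R (nth 0 G j)).
  have -> : pairing y v - pairing y (real_mx R z') =
    pairing y (v - real_mx R z) - (pairing y (real_mx R z') - pairing y (real_mx R z)).
    by rewrite pairBr; ring.
  rewrite z'z vE pair_sumr -sumrB; apply: eq_bigr => j _.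
  by rewrite pairZr mulrBl.
have up i : 0 <= pairing (real_mx R (sgn i)) (real_mx R z') - pairing (real_mx R (sgn i)) (real_mx R z).
  rewrite z'z sumr_ge0 // => j _; rewrite mulr_ge0 ?ler0n // pair_int ler0z sgnG //.
  exact: mem_nth.
have dn i : 0 <= pairing (real_mx R (sgn i)) v - pairing (real_mx R (sgn i)) (real_mx R z').
  rewrite vz' sumr_ge0 // => j _; have /andP[k0 _] := k01 j.
  by rewrite mulr_ge0 // pair_int ler0z sgnG // mem_nth.
exists z' => i; split.
  rewrite addrC -lerBlDr !dotE -opprB vz' (le_trans (ler_norm _)) // normrN.
  apply: le_trans (ler_norm_sum _ _ _) _; rewrite natr_sum ler_sum // => j _.
  have /andP[k0 k1] := k01 j; rewrite normrM (ger0_norm k0).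
  apply: le_trans (ler_wpM2r (normr_ge0 _) k1) _.
  rewrite mul1r pair_int -intr_norm (bigD1 i) //= natrD natr_absz lerDl.
  exact: ler0n.
have := up i; have := dn i; rewrite /sgn; case: (s i); rewrite !dotE.
  by rewrite !subr_ge0 => -> ->.
by rewrite real_mxN !pairNl => _; lra.
Qed.

(** Integral translations change right-hand sides by integers. *)
Lemma iter_cg_shift n k (X : set 'cV[R]_n) (z : 'cV[int]_n) x :
  iter k (@cg R n) X (x + real_mx R z) ->
  iter k (@cg R n) [set y | X (y + real_mx R z)] x.
Proof.
elim: k x => //= k IH x xX.
apply: (cg_mono (X := [set y | iter k (@cg R n) X (y + real_mx R z)])); first exact: IH.
move=> h c hc.
have := xX h (c + (ipair h z)%:~R); rewrite floorDint intrD dotE pairDr pair_int lerD2r.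
apply=> y yX; rewrite -lerBlDr.
have := hc (y - real_mx R z); rewrite /= subrK => /(_ yX).
by rewrite !dotE pairBr pair_int.
Qed.

(** Only finitely many systems have rows from [A] and bounded integral right-hand
    sides. *)
Lemma cg_bounded_rhs m n (A : 'M[int]_(m, n)) (C : nat) : exists N : nat,
  forall (T : {set 'I_m}) (b : 'cV[int]_m) z,
  (forall i, i \in T -> `|b i 0| <= C%:Z) -> sols R (subsystem A b T) (real_mx R z) ->
  iter N (@cg R n) (sols R (subsystem A b T)) `<=` integer_hull (sols R (subsystem A b T)).
Proof.
pose rhs_of (f : {ffun 'I_m -> 'I_(2 * C).+1}) : 'cV[int]_m :=
  \col_i ((f i : nat)%:Z - C%:Z).
have [|[T f]|N NP] := @uniform_bound ({set 'I_m} * {ffun 'I_m -> 'I_(2 * C).+1})%type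
  (fun Tf N => forall z, sols R (subsystem A (rhs_of Tf.2) Tf.1) (real_mx R z) ->
    iter N (@cg R n) (sols R (subsystem A (rhs_of Tf.2) Tf.1)) `<=`
    integer_hull (sols R (subsystem A (rhs_of Tf.2) Tf.1))).
- by move=> Tf N N' leN H z zS; apply: subset_trans (H z zS); apply: iter_cg_antimono.
- have [[z zS]|no] := pselect (exists z, sols R (subsystem A (rhs_of f) T) (real_mx R z)).
    by have [N NP] := cg_finite zS; exists N.
  by exists 0%N => z zS; case: no; exists z.
exists N => T b z bC.
have -> : subsystem A b T =
    subsystem A (rhs_of [ffun i => inord (absz (b i ord0 + C%:Z))]) T.
  rewrite /subsystem; apply/eq_in_map => i; rewrite mem_enum => /bC.
  rewrite !mxE ffunE; move: (b i 0) => t tC; congr (_, _).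
  by rewrite inordK; lia.
exact: NP (T, [ffun i => inord (absz (b i ord0 + C%:Z))]) z.
Qed.

(** Let [w x <= p.2] be an inequality of the integer hull and [v] a maximizer of [w]
    on the polyhedron.  Dropping the rows whose slack at [v] exceeds the proximity
    constant does not increase the maximum of [w] over lattice points: by
    [proximity] a lattice point of the relaxed system can be replaced by one that
    satisfies the dropped rows too, and [w] does not decrease, being a nonnegative
    combination of rows that are tight at [v].  So the integer hull of the relaxed
    system, which falls under [cg_bounded_rhs] after translation, yields the
    inequality. *)
Theorem cg_uniform m n (A : 'M[int]_(m, n)) : exists N : nat,
  forall (b : 'cV[int]_m) z, Qb (R := R) A b (real_mx R z) ->
  iter N (@cg R n) (Qb (R := R) A b) `<=` integer_hull (Qb (R := R) A b).
Proof.
have [D DP] := proximity A.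
pose B := (\sum_(i < m) \sum_(j < n) absz (A i j))%N.
have [N NP] := cg_bounded_rhs A (D + B).
exists N => b z1; rewrite QbE => z1S.
have [M [MP MS]] := integer_hull_finite z1S.
move=> x xN; apply: MS => p pM.
set w := p.1.
have [c wc] := bounded_of_lattice z1S (fun z => MP p z pM).
have [v [l [vS l0 wE wv]]] := lp_duality (w := real_mx R w) z1S wc.
(* Complementary slackness. *)
have slack i : (i < size (subsystem A b [set: 'I_m]))%N ->
    l i * (rhs R (subsystem A b [set: 'I_m]) i - pairing (lhs R (subsystem A b [set: 'I_m]) i) v) = 0.
  move=> lt_i.
  have /eqP : \sum_(i < size (subsystem A b [set: 'I_m]))
    l i * (rhs R (subsystem A b [set: 'I_m]) i - pairing (lhs R (subsystem A b [set: 'I_m]) i) v) = 0.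
    under eq_bigr do rewrite mulrBr.
    rewrite sumrB -wv wE pair_suml; under eq_bigr do rewrite pairZl.
    by rewrite subrr.
  rewrite psumr_eq0 => [/allP/(_ (Ordinal lt_i))|j _].
    by rewrite mem_index_enum => /(_ isT)/eqP.
  by rewrite mulr_ge0 // subr_ge0 sols_nth.
pose T : {set 'I_m} := finset (fun i => (b i 0)%:~R - dot (row i A) v <= D%:R).
pose z0 : 'cV[int]_n := \col_j Num.floor (v j 0).
pose b' := b - A *m z0.
have shiftE : [set y | sols R (subsystem A b T) (y + real_mx R z0)] =
    sols R (subsystem A b' T).
  have E i : (b' i 0)%:~R = (b i 0)%:~R - dot (row i A) (real_mx R z0) :> R.
    by rewrite dotE pair_int /b' -intrB; congr (_%:~R); rewrite !mxE /ipair -row_mul !mxE.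
  apply/seteqP; split=> y /sols_subsystem H; apply/sols_subsystem => i iT;
    have := H i iT; rewrite E !dotE pairDr; lra.
have b'C i : i \in T -> `|b' i 0| <= (D + B)%N%:Z.
  rewrite inE => biD.
  have bi : dot (row i A) v <= (b i 0)%:~R.
    by move: vS => /sols_subsystem/(_ i); apply; rewrite inE.
  have E : (b' i 0)%:~R = ((b i 0)%:~R - dot (row i A) v) +
      dot (row i A) (v - real_mx R z0) :> R.
    rewrite !dotE pairBr pair_int.
    have -> : b' i 0 = b i 0 - ipair (row i A) z0.
      by rewrite !mxE /ipair -row_mul !mxE.
    by rewrite intrB; ring.
  rewrite -(ler_int R) intr_norm E -pmulrn natrD.
  apply: le_trans (ler_normD _ _) _; apply: lerD; first by rewrite ger0_norm // subr_ge0.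
  rewrite /dot mxE (le_trans (ler_norm_sum _ _ _)) // /B (bigD1 i) //= natrD.
  rewrite (le_trans _ (_ : (\sum_j absz (A i j))%N%:R <= _)) ?lerDl ?ler0n // natr_sum.
  rewrite ler_sum // => j _; rewrite !mxE normrM natr_absz -intr_norm.
  have /andP[f1 /ltW f2] := floor_itv (v j 0); rewrite intrD in f2.
  by rewrite ler_piMr ?ler0z // ger0_norm ?subr_ge0 //; lra.
have xT : iter N (@cg R n) (sols R (subsystem A b T)) x.
  apply: iter_cg_mono xN => y /sols_subsystem H; apply/sols_subsystem => i _.
  by apply: H; rewrite inE.
have := @iter_cg_shift _ N (sols R (subsystem A b T)) z0 (x - real_mx R z0).
rewrite subrK shiftE => /(_ xT) xT'.
have z1T : sols R (subsystem A b' T) (real_mx R (z1 - z0)).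
  rewrite -shiftE /= real_mxB subrK; apply/sols_subsystem => i _.
  by move: z1S => /sols_subsystem; apply; rewrite inE.
have := NP T b' _ b'C z1T _ xT'.
move=> /(@conv_le _ _ w (p.2%:~R - dot w (real_mx R z0))).
rewrite !dotE pairBr lerD2r; apply=> q [yS [y qE]]; move: yS; rewrite {q}qE -lerBlDr opprK -!/(real_mx R _).
rewrite -shiftE /= -/(real_mx R y) -real_mxD => /sols_subsystem yS.
rewrite !dotE -pairDr -real_mxD.
have [z' z'P] := DP v (y + z0).
apply: (@le_trans _ _ (pairing (real_mx R w) (real_mx R z'))); last first.
  rewrite pair_int ler_int; apply: MP => //; apply/sols_subsystem => i _.
  have bi : dot (row i A) v <= (b i 0)%:~R.
    by move: vS => /sols_subsystem/(_ i); apply; rewrite inE.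
  have [z'D z'1 z'2] := z'P i.
  have [iT|iT] := boolP (i \in T); last first.
    by move: iT; rewrite inE -ltNge => iT; lra.
  have [le|lt] := leP (dot (row i A) (real_mx R (y + z0))) (dot (row i A) v).
    by have /andP[_ /le_trans] := z'1 le; apply.
  exact: le_trans (z'2 lt) (yS i iT).
rewrite wE !pair_suml ler_sum // => i _; rewrite !pairZl.
have [->|li] := eqVneq (l i) 0; first by rewrite !mul0r.
rewrite ler_wpM2l //.
have := slack i (ltn_ord i) => /eqP; rewrite mulf_eq0 (negPf li) /= subr_eq0 => /eqP.
rewrite /lhs /rhs; have /mapP[j _ ->] := mem_nth (0, 0) (ltn_ord i) => /= bj.
have jT : j \in T by rewrite inE bj dotE subrr ler0n.
have [_ z'1 _] := z'P j.
have /z'1/andP[] // : dot (row j A) (real_mx R (y + z0)) <= dot (row j A) v.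
by rewrite [X in _ <= X]dotE -bj; apply: yS.
Qed.

End Uniform.

(** * Basic solutions and bases *)

Section Normalization.
Variable R : realType.

Lemma cone_conic n (S : set 'rV[int]_n) (s : seq 'rV[int]_n) (y : 'rV[R]_n) :
  (forall a, S a <-> a \in s) -> cone S y <-> conic s y.
Proof.
move=> Ss; split=> [[k [a [c [aS c0 ->]]]]|[c [c0 ->]]].
  by apply: conic_sum => i _; apply: conicZ => //; apply/conic_mem/Ss.
exists (size s), (fun i : 'I__ => nth 0 s i), (fun i : 'I__ => c i); split=> // i.
by apply/Ss/mem_nth.
Qed.

(** Minimality is with respect to inclusion, so one descends from any finite
    Hilbert basis. *)
Lemma min_hilbert_basis_exists n (s : seq 'rV[int]_n) (S : set 'rV[int]_n) :
  (forall a, S a <-> a \in s) -> exists H, min_hilbert_basis (cone (R := R) S) H.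
Proof.
move=> Ss.
suff exmin (H : {fset 'rV[int]_n}) : hilbert_basis (cone (R := R) S) H ->
    exists H', min_hilbert_basis (cone (R := R) S) H'.
  have [H [Hs HP]] := hilbert_finite R s; apply: (exmin H); split.
    by move=> h /Hs; rewrite -(cone_conic _ Ss).
  by move=> z /(cone_conic _ Ss)/HP.
have [k] := ubnP #|` H|; elim: k H => // k IH H; rewrite ltnS => Hk HS.
have [[H' [HS' [sub ne]]]|no] := pselect (exists H', hilbert_basis (cone (R := R) S) H' /\
    ((H' `<=` H)%fset /\ H' != H)).
  apply: (IH H') => //; apply: leq_trans Hk; apply: fproper_ltn_card.
  by rewrite fproperEneq ne.
exists H; split=> // H' HS' sub; apply/eqP; apply: contrapT => /negP ne.
by apply: no; exists H'.
Qed.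

Lemma not_free n (X : seq 'rV[R]_n) : ~~ free X ->
  exists2 d : nat -> R, exists2 i, (i < size X)%N & d i != 0 &
    \sum_(i < size X) d i *: X`_i = 0.
Proof.
move=> nX; apply: contrapT => no; move: nX => /negP; apply.
apply/(@freeP _ _ _ (in_tuple X)) => d d0 i; apply: contrapT => /eqP di; apply: no.
exists (fun j => if insub j is Some j' then d j' else 0).
  by exists (i : nat) => //; rewrite valK.
by rewrite -[RHS]d0; apply: eq_bigr => j _; rewrite valK.
Qed.

(** Each entry of [W] is an inequality with a weight.  Along a linear dependency of
    the normals, oriented so that the total right-hand side does not increase, some
    weight must decrease: the inequalities hold at [x0], so a nonnegative dependency
    has a nonnegative total.  Moving until a weight vanishes shortens the list. *)
Lemma caratheodory n (W : seq ('rV[int]_n * int * R)) (x0 : 'cV[R]_n) :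
  (forall q, q \in W -> 0 <= q.2 /\ dot q.1.1 x0 <= q.1.2%:~R) ->
  exists W' : seq ('rV[int]_n * int * R),
  [/\ forall q, q \in W' -> 0 <= q.2 /\ exists2 q0, q0 \in W & q.1 = q0.1,
      \sum_(q <- W') q.2 *: real_mx R q.1.1 = \sum_(q <- W) q.2 *: real_mx R q.1.1,
      \sum_(q <- W') q.2 * q.1.2%:~R <= \sum_(q <- W) q.2 * q.1.2%:~R &
      free [seq real_mx R q.1.1 | q <- W']].
Proof.
have [k] := ubnP (size W); elim: k W => // k IH W; rewrite ltnS => Wk W0.
have [Wfree|] := boolP (free [seq real_mx R q.1.1 | q <- W]).
  by exists W; split=> // q qW; split; [case: (W0 q qW)|exists q].
pose q0 : 'rV[int]_n * int * R := (0, 0, 0).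
pose Q i := nth q0 W i.
have W0' (i : 'I_(size W)) : 0 <= (Q i).2 /\ dot (Q i).1.1 x0 <= (Q i).1.2%:~R.
  by apply: W0; apply: mem_nth.
have sumW (V : nmodType) (F : _ -> V) : \sum_(q <- W) F q = \sum_(i < size W) F (Q i).
  by rewrite (big_nth q0) big_mkord.
move=> /not_free[d [i1 lt_i1 di1]]; rewrite size_map in lt_i1 *.
under eq_bigr => i _ do rewrite (nth_map q0) // -/(Q i).
move=> d0.
(* Orientation of the dependency. *)
wlog : d i1 lt_i1 di1 d0 / \sum_(i < size W) d i * (Q i).1.2%:~R <= 0 /\
    exists2 i : 'I_(size W), true & d i < 0.
  move=> main.
  have neg e : \sum_(i < size W) e i *: real_mx R (Q i).1.1 = 0 ->
      \sum_(i < size W) e i * (Q i).1.2%:~R < 0 -> exists2 i : 'I_(size W), true & e i < 0.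
    move=> e0 es; apply: contrapT => no; move: es; apply/negP; rewrite -leNgt.
    have sum0 : \sum_(i < size W) e i * dot (Q i).1.1 x0 = 0.
      transitivity (pairing (\sum_(i < size W) e i *: real_mx R (Q i).1.1) x0).
        by rewrite pair_suml; apply: eq_bigr => i _; rewrite pairZl.
      by rewrite e0 pair0l.
    rewrite -[X in X <= _]sum0; apply: ler_sum => i _.
    have [_ Wi] := W0' i; rewrite ler_wpM2l // leNgt.
    by apply/negP => ei; apply: no; exists i.
  have dN : \sum_(i < size W) (- d i) *: real_mx R (Q i).1.1 = 0.
    by under eq_bigr do rewrite scaleNr; rewrite sumrN d0 oppr0.
  have dNE : \sum_(i < size W) (- d i) * (Q i).1.2%:~R = - \sum_(i < size W) d i * (Q i).1.2%:~R.
    by under eq_bigr do rewrite mulNr; rewrite sumrN.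
  have [lt|lt|eq] := ltgtP (\sum_(i < size W) d i * (Q i).1.2%:~R) 0.
  - by apply: (main d i1) => //; split; [exact: ltW|apply: neg].
  - apply: (main (fun i => - d i) i1); rewrite ?oppr_eq0 // dNE oppr_le0 ltW //.
    by split=> //; apply: neg; rewrite // dNE oppr_lt0.
  - have [d1|d1] := ltP (d i1) 0.
      by apply: (main d i1) => //; rewrite eq; split=> //; exists (Ordinal lt_i1).
    apply: (main (fun i => - d i) i1); rewrite ?oppr_eq0 // dNE eq oppr0.
    by split=> //; exists (Ordinal lt_i1); rewrite //= oppr_lt0 lt_neqAle eq_sym di1.
move=> [ds [i2 _ di2]].
case: (@arg_minP _ _ _ i2 (fun i : 'I_(size W) => d i < 0)
   (fun i : 'I_(size W) => (Q i).2 / - d i) di2) => /= i dneg imin.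
pose t := (Q i).2 / - d i.
have t0 : 0 <= t by rewrite divr_ge0 ?oppr_ge0 ?(ltW dneg) //; case: (W0' i).
pose y j := (Q j).2 + t * d j.
have y0 (j : 'I_(size W)) : 0 <= y j.
  have [Qj _] := W0' j; rewrite /y; have [dj|dj] := ltP (d j) 0.
    by have := imin j dj; rewrite ler_pdivlMr ?oppr_gt0 //; rewrite -/t; lra.
  by rewrite addr_ge0 // mulr_ge0.
have yi : y i = 0.
  by rewrite /y /t invrN mulrN mulNr -mulrA mulVf ?lt_eqF // mulr1 subrr.
pose W2 := [seq ((Q j).1, y j) | j : 'I_(size W) <- enum 'I_(size W)].
pose W3 := [seq q <- W2 | q.2 != 0].
have sumW3 (V : lmodType R) (F : 'rV[int]_n * int -> V) :
    \sum_(q <- W3) q.2 *: F q.1 = \sum_(j < size W) y j *: F (Q j).1.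
  rewrite big_filter big_mkcond big_map big_enum /=; apply: eq_bigr => j _.
  by case: eqP => // ->; rewrite scale0r.
have [|q|W' [W'1 W'2 W'3 W'4]] := IH W3.
- apply: leq_trans Wk; rewrite size_filter.
  have <- : size W2 = size W by rewrite size_map size_enum_ord.
  rewrite ltn_neqAle count_size andbT -all_count; apply/negP => /allP H.
  have /H : ((Q i).1, y i) \in W2 by apply/mapP; exists i; rewrite ?mem_enum.
  by rewrite /= yi eqxx.
- rewrite mem_filter => /andP[_ /mapP[j _ ->]] /=; split=> //.
  by case: (W0' j).
exists W'; split=> // [q /W'1[q2 [r rW3 ->]]||].
- split=> //; move: rW3; rewrite mem_filter => /andP[_ /mapP[j _ ->]] /=.
  by exists (Q j) => //; apply: mem_nth.
- rewrite W'2 (sumW3 _ (fun r => real_mx R r.1)) sumW.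
  under eq_bigr do rewrite /y scalerDl -scalerA.
  by rewrite big_split /= -scaler_sumr d0 scaler0 addr0.
apply: le_trans W'3 _; rewrite (sumW3 R^o (fun r => r.2%:~R)) sumW.
under eq_bigr do rewrite /y scalerDl -scalerA.
by rewrite big_split /= -scaler_sumr gerDl; apply: mulr_ge0_le0.
Qed.

Lemma free_extend n (X L : seq 'rV[int]_n) : free (map (@real_mx R 1 n) X) ->
  exists Y, [/\ {subset X <= Y}, {subset Y <= X ++ L}, free (map (@real_mx R 1 n) Y) &
    forall a, a \in L -> real_mx R a \in <<map (@real_mx R 1 n) Y>>%VS].
Proof.
elim: L X => [|b L IH] X Xf.
  by exists X; split=> // a; rewrite cats0.
have [bX|bX] := boolP (real_mx R b \in <<map (@real_mx R 1 n) X>>%VS).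
  have [Y [XY YL Yf YP]] := IH X Xf; exists Y; split=> // a.
    by move=> /YL; rewrite !mem_cat inE => /orP[->//|->]; rewrite !orbT.
  rewrite inE => /predU1P[->|]; last exact: YP.
  apply: (subvP (sub_span _)) bX => _ /mapP[c cX ->]; apply: map_f; exact: XY.
have [|Y [XY YL Yf YP]] := IH (b :: X); first by rewrite /= free_cons bX.
exists Y; split=> // a; first by move=> aX; apply: XY; rewrite inE aX orbT.
  by move=> /YL; rewrite !mem_cat !inE => /orP[/orP[]|] ->; rewrite ?orbT.
rewrite inE => /predU1P[->|]; last exact: YP.
by apply/memv_span/map_f/XY; rewrite mem_head.
Qed.

Definition spanning n (L : seq 'rV[int]_n) : Prop :=
  forall y : 'rV[R]_n, y \in <<map (@real_mx R 1 n) L>>%VS.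

Lemma row_free_real n (B : 'M[int]_n) :
  row_free (map_mx intr B : 'M[rat]_n) = row_free (real_mx R B).
Proof.
have -> : real_mx R B = map_mx (@ratr R) (map_mx intr B).
  by apply/matrixP => i j; rewrite !mxE ratr_int.
by rewrite /row_free mxrank_map.
Qed.

(** Linear independence is tested over the reals here and over the rationals in
    [basis_in]; the rank of an integral matrix is the same over both. *)
Lemma basis_extend n (X L : seq 'rV[int]_n) : spanning L ->
  free (map (@real_mx R 1 n) X) -> {subset X <= L} ->
  exists B : 'M[int]_n, basis_in [set` L] B /\ forall a, a \in X -> exists i, a = row i B.
Proof.
move=> sL Xf XL; have [Y [XY YL Yf YP]] := free_extend L Xf.
have YL' : {subset Y <= L}.
  by move=> a /YL; rewrite mem_cat => /orP[/XL|].
have Yfull : <<map (@real_mx R 1 n) Y>>%VS = fullv.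
  apply/vspaceP => y; rewrite memvf; apply: (subvP _ _ (sL y)).
  by apply/span_subvP => _ /mapP[a aL ->]; apply: YP.
have Yn : size Y = n.
  have : size (map (@real_mx R 1 n) Y) = \dim (fullv : {vspace 'rV[R]_n}).
    by rewrite -Yfull; apply/esym/eqP.
  by rewrite size_map dimvf /dim /= mul1n.
exists (\matrix_i nth 0 Y i); split; last first.
  move=> a /XY/(nthP 0)[i]; rewrite Yn => lt_i <-.
  by exists (Ordinal lt_i); rewrite rowK.
split; last by move=> i; rewrite rowK /=; apply/YL'/mem_nth; rewrite Yn.
rewrite row_free_real; apply: inj_row_free => v.
rewrite mulmx_sum_row => v0; apply/rowP => i; rewrite mxE.
have lt_i : (i < size (map (@real_mx R 1 n) Y))%N by rewrite size_map Yn.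
pose k (j : 'I_(size (map (@real_mx R 1 n) Y))) : R := if insub (j : nat) is Some j' then v 0 j' else 0.
have := @freeP _ _ _ (in_tuple (map (@real_mx R 1 n) Y)) Yf k _ (Ordinal lt_i).
rewrite /k /= valK; apply; rewrite -[RHS]v0.
have E : size (map (@real_mx R 1 n) Y) = n by rewrite size_map Yn.
rewrite (reindex (cast_ord (esym E))) /=; last first.
  by exists (cast_ord E) => j _; rewrite ?cast_ordK ?cast_ordKV.
apply: eq_bigr => j _; rewrite valK; congr (_ *: _).
by rewrite (nth_map 0) ?Yn // /real_mx -map_row rowK.
Qed.

End Normalization.

(** * Basis normalization performs cuts *)

Section SmallRank.
Variable R : realType.

Definition row_seq m n (B : 'M[int]_(m, n)) : seq 'rV[int]_n :=
  [seq row i B | i <- enum 'I_m].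

Lemma mem_row_seq m n (B : 'M[int]_(m, n)) a : rows B a <-> a \in row_seq B.
Proof.
split=> [[i _ <-]|/mapP[i _ ->]]; last by exists i.
by apply/mapP; exists i; rewrite ?mem_enum.
Qed.

Lemma spanning_rows m n (B : 'M[int]_(m, n)) (L : seq 'rV[int]_n) :
  row_full (real_mx R B) ->
  (forall i, real_mx R (row i B) \in <<map (@real_mx R 1 n) L>>%VS) -> spanning R L.
Proof.
move=> Bfull BL y; have [u ->] := submxP (submx_full y Bfull).
rewrite mulmx_sum_row; apply: memv_suml => i _; apply: memvZ.
by rewrite /real_mx -map_row; apply: BL.
Qed.

Lemma natcomb_span n (L H : seq 'rV[int]_n) z : {subset H <= L} -> natcomb H z ->
  real_mx R z \in <<map (@real_mx R 1 n) L>>%VS.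
Proof.
move=> HL [c ->]; rewrite real_mx_sum big_seq; apply: memv_suml => h hH.
by rewrite real_mxMn -scaler_nat; apply/memvZ/memv_span/map_f/HL.
Qed.

(** A finite part of the next stage that contains a Hilbert basis of every basis
    cone of [L]; finiteness is what linear programming duality needs. *)
Lemma normalization_list n (L : seq 'rV[int]_n) : spanning R L ->
  exists L' : seq 'rV[int]_n,
  [/\ forall h, h \in L' -> basis_normalization R [set` L] h, spanning R L' &
    forall B, basis_in [set` L] B -> exists H : {fset 'rV[int]_n},
      min_hilbert_basis (cone (R := R) (rows B)) H /\ {subset H <= L'}].
Proof.
move=> sL.
have /choice[hb hbP] : forall B : 'M[int]_n, exists H, min_hilbert_basis (cone (R := R) (rows B)) H.
  by move=> B; apply: min_hilbert_basis_exists (mem_row_seq B).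
pose Bf (f : {ffun 'I_n -> 'I_(size L)}) : 'M[int]_n := \matrix_i nth 0 L (f i).
pose L' := flatten [seq (hb (Bf f) : seq _) | f <- enum {ffun 'I_n -> 'I_(size L)} &
   row_free (map_mx intr (Bf f) : 'M[rat]_n)].
have L'B B : basis_in [set` L] B -> {subset hb B <= L'}.
  move=> [Bf' BL] h hB; apply/flattenP; exists (hb B : seq _) => //.
  have lt_i i : (index (row i B) L < size L)%N by rewrite index_mem; apply: BL.
  have BE : B = Bf [ffun i => Ordinal (lt_i i)].
    by apply/row_matrixP => i; rewrite rowK ffunE nth_index //; apply: BL.
  apply/mapP; exists [ffun i => Ordinal (lt_i i)]; last by rewrite -BE.
  by rewrite mem_filter mem_enum andbT -BE.
exists L'; split.
- move=> h /flattenP[s /mapP[f]]; rewrite mem_filter => /andP[Bfree _] -> hH.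
  exists (Bf f), (hb (Bf f)); split=> //; split=> // i.
  by rewrite rowK /=; apply: mem_nth.
- have [//|B [BL _]] := basis_extend (X := [::]) sL (nil_free _).
  have [[_ HB] _] := hbP B.
  apply: (@spanning_rows _ _ B).
    by rewrite row_full_unit -row_free_unit -row_free_real; case: BL.
  move=> i; apply: (natcomb_span (L'B B BL)); apply: HB.
  by apply/(cone_conic _ (mem_row_seq B))/conic_mem/mem_row_seq; exists i.
- by move=> B BL; exists (hb B); split=> //; apply: L'B.
Qed.

(** The value [d] of the support function of the integer hull of [Q] at [h],
    expressed by lattice points only. *)
Definition supports n (Q : set 'cV[R]_n) (h : 'rV[int]_n) (d : int) : Prop :=
  (forall z, Q (real_mx R z) -> ipair h z <= d) /\
  exists z, Q (real_mx R z) /\ ipair h z = d.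

Lemma supports_exists n (Q : set 'cV[R]_n) z1 h (c : R) :
  Q (real_mx R z1) -> (forall x, Q x -> dot h x <= c) -> exists d, supports Q h d.
Proof.
move=> z1Q hc.
have le_floor z : Q (real_mx R z) -> ipair h z <= Num.floor c.
  by move=> /hc; rewrite dotE pair_int floor_ge_int.
pose P k := `[< exists z, Q (real_mx R z) /\ ipair h z = Num.floor c - k%:Z >].
have exP : exists k, P k.
  exists (absz (Num.floor c - ipair h z1)); apply/asboolP; exists z1; split=> //.
  by have := le_floor z1 z1Q; lia.
case: (ex_minnP exP) => k /asboolP[z [zQ zk]] kmin.
exists (Num.floor c - k%:Z); split; last by exists z.
move=> z' z'Q; have := le_floor z' z'Q => le'.
suff : (k <= absz (Num.floor c - ipair h z'))%N by lia.
by apply: kmin; apply/asboolP; exists z'; split=> //; lia.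
Qed.

Definition support_cut n (V : set 'rV[int]_n) (d : 'rV[int]_n -> int) : set 'cV[R]_n :=
  [set x | forall a, V a -> dot a x <= (d a)%:~R].

(** Let [h x <= c] be valid at stage [L].  Duality and [caratheodory] express [h]
    through independent normals, which extend to a basis [B]; let [u] be the point
    where the rows of [B] take their right-hand sides.  The point [u] may violate
    other inequalities of the stage.  Still each element [a] of the Hilbert basis
    of the cone of [B] has a right-hand side of at most [a u], since its value at a
    lattice point of [Q] is bounded through the rows of [B].  Summing over the
    integral decomposition of [h] gives an integer between [h x] and [h u <= c]. *)
Lemma normalization_cut n (Q : set 'cV[R]_n) z1 (d : 'rV[int]_n -> int)
    (L L' : seq 'rV[int]_n) :
  Q (real_mx R z1) -> spanning R L ->
  (forall a, a \in L -> supports Q a (d a)) ->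
  (forall a, a \in L' -> supports Q a (d a)) ->
  (forall B, basis_in [set` L] B -> exists H : {fset 'rV[int]_n},
      min_hilbert_basis (cone (R := R) (rows B)) H /\ {subset H <= L'}) ->
  support_cut [set` L'] d `<=` cg (support_cut [set` L] d).
Proof.
move=> z1Q sL Ld L'd L'H x xL' h c hc.
pose S : system n := [seq (a, d a) | a <- L].
have SE y : sols R S y <-> support_cut [set` L] d y.
  split=> [H a aL|H _ /mapP[a aL ->]]; last exact: H.
  by apply: (H (a, d a)); apply/mapP; exists a.
have z1S : sols R S (real_mx R z1).
  apply/SE => a aL; rewrite dotE pair_int ler_int.
  by have [] := Ld a aL => + _; apply.
have [y [l [yS l0 hE hy]]] := lp_duality (w := real_mx R h) z1S (fun y yS => hc y (proj1 (SE y) yS)).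
pose W : seq ('rV[int]_n * int * R) := [seq (nth (0, 0) S i, l i) | i : 'I_(size S) <- enum 'I_(size S)].
have WS q : q \in W -> 0 <= q.2 /\ q.1 \in S.
  by move=> /mapP[i _ ->]; split=> //=; apply: mem_nth.
have [|W' [W'1 W'2 W'3 W'4]] := @caratheodory R n W (real_mx R z1).
  by move=> q /WS[q0 qS]; split=> //; apply: z1S.
have W'S q : q \in W' -> q.1.1 \in L /\ q.1.2 = d q.1.1.
  by move=> /W'1[_ [r /WS[_ rS] ->]]; move: rS => /mapP[a aL ->].
have {}W'2 : real_mx R h = \sum_(q <- W') q.2 *: real_mx R q.1.1.
  by rewrite W'2 big_map big_enum hE.
have {}W'3 : \sum_(q <- W') q.2 * (d q.1.1)%:~R <= c.
  apply: le_trans (hc y (proj1 (SE y) yS)); rewrite dotE hy.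
  apply: le_trans (le_trans _ W'3) _; last by rewrite big_map big_enum.
  rewrite big_seq [X in _ <= X]big_seq; apply: ler_sum => q /W'S[_ ->].
  exact: lexx.
have [|a|B [BL XB]] := basis_extend (X := [seq q.1.1 | q <- W']) sL.
- by rewrite -map_comp.
- by move=> /mapP[q /W'S[qL _] ->].
have [H [[[HK HP] _] HL']] := L'H B BL.
have Bu : real_mx R B \in unitmx by rewrite -row_free_unit -row_free_real; case: BL.
pose u := invmx (real_mx R B) *m \col_i (d (row i B))%:~R.
have uB i : dot (row i B) u = (d (row i B))%:~R.
  by rewrite /dot map_row -row_mul /u mulKVmx // !mxE.
have uX a : a \in [seq q.1.1 | q <- W'] -> dot a u = (d a)%:~R.
  by move=> /XB[i ->].
have Hu a : a \in H -> (d a)%:~R <= dot a u.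
  move=> aH; have [_ [z [zQ <-]]] := L'd a (HL' a aH).
  have [k [s [e [sB e0 aE]]]] := HK a aH.
  rewrite -pair_int /dot -!/(pairing _ _) -/(real_mx R a) [real_mx R a]aE !pair_suml.
  apply: ler_sum => i _; rewrite !pairZl ler_wpM2l //.
  have [j _ <-] := sB i; rewrite -/(real_mx R _) pair_int -dotE uB ler_int.
  by have [+ _] := Ld _ (proj2 BL j); apply.
have [e hH] : natcomb H h.
  apply: HP; rewrite -/(real_mx R h) W'2; apply/(cone_conic _ (mem_row_seq B)).
  rewrite big_seq; apply: conic_sum => q qW'; apply: conicZ; first by case: (W'1 q qW').
  have [i ->] := XB _ (map_f (fun q => q.1.1) qW'); apply: conic_mem.
  by apply/mem_row_seq; exists i.
have sumE (v : 'cV[R]_n) : dot h v = \sum_(a <- H) (e a)%:R * dot a v.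
  rewrite dotE hH real_mx_sum pair_suml; apply: eq_bigr => a _.
  by rewrite real_mxMn -scaler_nat pairZl.
apply: (@le_trans _ _ (\sum_(a <- H) (e a)%:R * (d a)%:~R)).
  rewrite sumE big_seq [X in _ <= X]big_seq; apply: ler_sum => a aH.
  by rewrite ler_wpM2l // xL' //=; apply: HL'.
have -> : \sum_(a <- H) (e a)%:R * (d a)%:~R = (\sum_(a <- H) (e a)%:Z * d a)%:~R :> R.
  by rewrite rmorph_sum; apply: eq_bigr => a _; rewrite rmorphM.
rewrite ler_int floor_ge_int rmorph_sum; apply: le_trans W'3.
apply: (@le_trans _ _ (dot h u)).
  rewrite sumE big_seq [X in _ <= X]big_seq; apply: ler_sum => a aH.
  by rewrite rmorphM /= ler_wpM2l // Hu.
rewrite dotE W'2 pair_suml big_seq [X in _ <= X]big_seq; apply: ler_sum => q qW'.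
by rewrite pairZl -dotE uX // (map_f (fun q => q.1.1)).
Qed.

End SmallRank.

(** * Comparison of the ranks *)

Section Ranks.
Variable R : realType.

(** All normals stay in the cone generated by the rows of [A]. *)
Lemma ibn_bounded m n (A : 'M[int]_(m, n)) b k h : ibn R A k h ->
  exists c : R, forall x, Qb (R := R) A b x -> dot h x <= c.
Proof.
elim: k h => [_ [i _ <-]|k IH h /= [B [H [[_ Bk] [[HK _] _] hH]]]].
  by exists ((map_mx intr b) i ord0) => x; apply.
have /(cone_conic _ (mem_row_seq B)) := HK h hH.
move=> /(conic_bounded_below (X := [set x | Qb (R := R) A b (- x)]))[|c hc].
  move=> _ /mem_row_seq[i _ <-]; have [c ic] := IH _ (Bk i).
  by exists (- c) => x /ic; rewrite !dotE pairNr lerNl.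
exists (- c) => x xQ; have := hc (- x); rewrite /= opprK => /(_ xQ).
by rewrite pairNr lerNr.
Qed.

Lemma basis_normalization_sub n (V W : set 'rV[int]_n) : V `<=` W ->
  basis_normalization R V `<=` basis_normalization R W.
Proof.
by move=> VW h [B [H [[Bf BV] HB hH]]]; exists B, H; split=> //; split=> // i; apply/VW/BV.
Qed.

(** The induction runs over finite spanning lists of normals, because spanning is
    what allows independent normals to be completed to bases. *)
Lemma ibn_cut m n (A : 'M[int]_(m, n)) b z1 (d : 'rV[int]_n -> int) k :
  int_rank A = n -> Qb (R := R) A b (real_mx R z1) ->
  (forall j h, ibn R A j h -> supports (Qb (R := R) A b) h (d h)) ->
  support_cut (R := R) (ibn R A k) d `<=` iter k (@cg R n) (Qb (R := R) A b).
Proof.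
move=> Arank z1Q dP.
suff [L [LA _]] : exists L : seq 'rV[int]_n, [/\ [set` L] `<=` ibn R A k, spanning R L &
    support_cut (R := R) [set` L] d `<=` iter k (@cg R n) (Qb (R := R) A b)].
  by apply: subset_trans => x xV a /LA; apply: xV.
elim: k => [|k [L [LA sL Lcut]]].
  exists (row_seq A); split.
  - by move=> a /mem_row_seq.
  - apply: (@spanning_rows R _ _ A).
      rewrite /row_full -[X in _ == X]Arank /int_rank.
      have -> : real_mx R A = map_mx (@ratr R) (map_mx intr A).
        by apply/matrixP => i j; rewrite !mxE ratr_int.
      by rewrite mxrank_map.
    by move=> i; apply/memv_span/map_f/mem_row_seq; exists i.
  - move=> x xA i; rewrite mxE.
    have iA : rows A (row i A) by exists i.
    apply: (le_trans (xA (row i A) _)); first by apply/mem_row_seq.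
    have [_ [z [zQ <-]]] := dP 0%N _ iA.
    by have := zQ i; rewrite mxE dotE pair_int.
have [L' [L'V sL' L'H]] := normalization_list sL.
have L'A : [set` L'] `<=` ibn R A k.+1.
  by move=> h /L'V; apply: basis_normalization_sub.
exists L'; split=> //=; apply: subset_trans (cg_mono Lcut).
apply: (normalization_cut z1Q) => // a aL; first by apply: (dP k); apply: LA.
by apply: (dP k.+1); apply: L'A.
Qed.

Lemma scr_at_stage_cg m n (A : 'M[int]_(m, n)) b z1 k :
  int_rank A = n -> Qb (R := R) A b (real_mx R z1) ->
  iter k (@cg R n) (Qb (R := R) A b) `<=` integer_hull (Qb (R := R) A b) -> scr_at_stage R A b k.
Proof.
move=> Arank z1Q kQ.
have /choice[d dP] : forall h, exists e, (exists j, ibn R A j h) -> supports (Qb (R := R) A b) h e.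
  move=> h; have [[j jh]|no] := pselect (exists j, ibn R A j h); last by exists 0.
  have [c hc] := ibn_bounded b jh; have [e he] := supports_exists z1Q hc.
  by exists e.
have dP' j h : ibn R A j h -> supports (Qb (R := R) A b) h (d h).
  by move=> jh; apply: dP; exists j.
exists d; apply/seteqP; split; last exact: subset_trans (ibn_cut Arank z1Q dP') kQ.
move=> x xh a aV; apply: conv_le xh => y [yQ [z zE]].
move: yQ; rewrite zE dotE pair_int ler_int => zQ.
by have [+ _] := dP' _ _ aV; apply.
Qed.

(** An element of the cone of the tight rows at [v] attains its maximum over [Q]
    at [v]. *)
Lemma cg_chvatal_closure n (Q Q' : set 'cV[R]_n) : chvatal_closure Q Q' -> cg Q `<=` Q'.
Proof.
move=> [m [U [u [H [_ QE HP ->]]]]] x xQ v vQ h hH; apply: xQ => y yQ.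
have [[HK _] _] := HP v vQ.
have [k [s [c [sU c0 hE]]]] := HK h hH.
rewrite /dot hE -!/(pairing _ _) !pair_suml ler_sum // => i _.
rewrite !pairZl ler_wpM2l //; have [j /= jv <-] := sU i.
suff : dot (row j U) y <= dot (row j U) v by [].
by rewrite jv; move: yQ; rewrite QE; apply.
Qed.

Lemma cg_chvatal_iter n t (Q Q' : set 'cV[R]_n) :
  chvatal_iter t Q Q' -> iter t (@cg R n) Q `<=` Q'.
Proof.
elim: t Q' => [Q' -> //|t IH Q' /= [Q1 [/IH Q1t /cg_chvatal_closure Q1Q']]].
exact: subset_trans (cg_mono Q1t) Q1Q'.
Qed.

(** If every row of [A] were negative in some direction of the recession cone,
    integral points far out in that direction would satisfy the system.  So some row
    vanishes on the recession cone and is, by Farkas' lemma, a nonnegative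
    combination of the negatives of the rows; then the rows cannot all be
    at most [-1] at the same point. *)
Lemma scr_at_stage0_empty m n (A : 'M[int]_(m, n)) b :
  (forall z, ~ Qb (R := R) A b (real_mx R z)) -> scr_at_stage R A b 0.
Proof.
move=> noz; exists (fun=> -1); apply/seteqP; split=> x.
  move=> xh; suff : dot (0 : 'rV[int]_n) x <= (- 1).
    by rewrite dotE real_mx0 pair0l lerNr oppr0 ler10.
  by apply: conv_le xh => y [yQ [z zE]]; case: (noz z); rewrite -[real_mx R z]/(map_mx intr z) -zE.
move=> xA.
have [G [Gs GP]] := minkowski R [seq - row i A | i <- enum 'I_m].
have G0 i g : g \in G -> ipair (row i A) g <= 0.
  move=> gG; rewrite -oppr_ge0 -ipairNl; apply: Gs => //.
  by apply/mapP; exists i; rewrite ?mem_enum.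
pose u := \sum_(g <- G) g.
have uE w : ipair w u = \sum_(g <- G) ipair w g.
  by rewrite /ipair /u mulmx_sumr summxE.
have [allneg|] := pselect (forall i, ipair (row i A) u < 0).
  pose t := (\sum_(i < m) absz (b i ord0))%N.
  case: (noz (t%:Z *: u)) => i; rewrite mxE dotE pair_int ler_int.
  have -> : ipair (row i A) (t%:Z *: u) = t%:Z * ipair (row i A) u.
    by rewrite /ipair -scalemxAr mxE.
  have := allneg i; have : (absz (b i ord0) <= t)%N by rewrite /t (bigD1 i) //= leq_addr.
  move: (b i ord0) (ipair (row i A) u) t => q a t; nia.
move=> /existsNP[i /negP]; rewrite -leNgt => iu.
have iG g : g \in G -> ipair (row i A) g = 0.
  move=> gG; apply/eqP; rewrite eq_le G0 //=; move: iu.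
  rewrite uE (big_rem g) //= => /le_trans; apply; rewrite gerDl big_seq sumr_le0 //.
  by move=> g' /mem_rem; apply: G0.
have icone : conic [seq - row j A | j <- enum 'I_m] (real_mx R (row i A)).
  apply: farkas => y ys; have [|c [_ ->]] := GP (real_mx R y).
    by move=> a /ys; rewrite dotE pair_int ler0z.
  rewrite pair_sumr big1 // => j _; rewrite pairZr pair_int iG ?mulr0 //.
  exact: mem_nth.
have rowx j : dot (row j A) x <= -1 by have := xA (row j A); apply; exists j.
have := conic_pair_ge0 (x := x) _ icone; rewrite -dotE => /(_ _)/le_trans/(_ (rowx i)).
rewrite lerNr oppr0 ler10 => H; suff : false by []; apply: H.
move=> _ /mapP[j _ ->]; rewrite dotE real_mxN pairNl -dotE.
by have := rowx j; lra.
Qed.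

Lemma least_le (P : set nat) k : P k -> (least R P <= (k%:R)%:E)%E.
Proof. by move=> Pk; apply: ereal_inf_lbound; exists k. Qed.

Lemma le_least (P : set nat) (x : \bar R) :
  (forall k, P k -> (x <= (k%:R)%:E)%E) -> (x <= least R P)%E.
Proof. by move=> xP; apply: le_ereal_inf_tmp => _ [k Pk <-]; apply: xP. Qed.

Lemma least_ge0 (P : set nat) : (0 <= least R P)%E.
Proof. by apply: le_least => k _; rewrite lee_fin ler0n. Qed.

Lemma ge0_bounded_fin_num (x : \bar R) (c : R) : (0 <= x)%E -> (x <= c%:E)%E -> x \is a fin_num.
Proof. by move=> x0 xc; rewrite ge0_fin_numE // (le_lt_trans xc) // ltry. Qed.

Lemma scr_le_chvatal_rank m n (A : 'M[int]_(m, n)) b :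
  int_rank A = n -> (scr R A b <= chvatal_rank R A b)%E.
Proof.
move=> Arank; apply: le_least => t /= /cg_chvatal_iter tQ.
have [[z zQ]|noz] := pselect (exists z, Qb (R := R) A b (real_mx R z)).
  by apply/least_le/(scr_at_stage_cg Arank zQ).
apply: le_trans (least_le (k := 0%N) _) _; last by rewrite lee_fin ler_nat.
by apply: scr_at_stage0_empty => z zQ; apply: noz; exists z.
Qed.

Lemma scr_uniformly_bounded m n (A : 'M[int]_(m, n)) :
  int_rank A = n -> exists N : nat, forall b, (scr R A b <= (N%:R)%:E)%E.
Proof.
move=> Arank; have [N NQ] := cg_uniform R A; exists N => b.
have [[z zQ]|noz] := pselect (exists z, Qb (R := R) A b (real_mx R z)).
  by apply/least_le/(scr_at_stage_cg Arank zQ)/(NQ b z zQ).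
apply: le_trans (least_le (k := 0%N) _) _; last by rewrite lee_fin ler_nat.
by apply: scr_at_stage0_empty => z zQ; apply: noz; exists z.
Qed.

End Ranks.

Theorem proposition2p6 (R : realType) (m n : nat) (A : 'M[int]_(m, n))
    (hrank : int_rank A = n)
    (hprim : forall i : 'I_m, primitive (row i A)) :
  (forall b : 'cV[int]_m, (scr R A b <= chvatal_rank R A b)%E) /\
  (scr_matrix R A <= chvatal_rank_matrix R A)%E /\
  (forall b : 'cV[int]_m, scr R A b \is a fin_num) /\
  scr_matrix R A \is a fin_num.
Proof.
have scr_chv b := scr_le_chvatal_rank R b hrank.
have [N scrN] := scr_uniformly_bounded R hrank.
split=> //; split; last split.
- apply: ge_ereal_sup => _ [b _ <-]; apply: le_trans (scr_chv b) _.
  by apply: ereal_sup_ubound; exists b.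
- by move=> b; apply: ge0_bounded_fin_num (scrN b); apply: least_ge0.
- apply: (@ge0_bounded_fin_num _ _ N%:R).
    apply: le_trans (least_ge0 R (scr_at_stage R A 0)) _.
    by apply: ereal_sup_ubound; exists 0.
  by apply: ge_ereal_sup => _ [b _ <-].
Qed.
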